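(* Let $p>3$ be a prime number, let $f(x)=x^4+ax^2+bx+c\in\mathbb{Z}[x]$ be irreducible, $\theta$ a root of $f(x)$ in an algebraic closure of $\mathbb{Q}$, $K=\mathbb{Q}(\theta)$, and $\Delta=v_p(\operatorname{disc}(f))$. Suppose that $f(x)$ has a triple (and not $4$-tuple) root modulo $p$. Let $s_0$ be an integer not divisible by $p$ satisfying $$a\equiv-6s_0^2\pmod p,\quad b\equiv 8s_0^3\pmod p,\quad c\equiv-3s_0^4\pmod p,$$ and such that $v_p(a+6s_0^2)=v_p(f''(s_0)/2)>\Delta/6$. Denote $$u_0=v_p(f(s_0)),\quad u_1=v_p(f'(s_0)),\quad \sigma_0=f(s_0)/p^{u_0},\quad \sigma_1=f'(s_0)/p^{u_1}.$$ (1) The integer $s_0$ is irregular if and only if $2u_0=3u_1$ and $p\mid \sigma_1^3+27s_0\sigma_0^2$. (2) If $s_0$ is regular, take $s=s_0$; if $s_0$ is irregular, apply to $s_0$ the iteration method to obtain a regular $s$. Then a $p$-integral basis of $K$ is $$1,\quad \theta,\quad \frac{\theta^2+2s\theta+3s^2+a}{p^{\nu_2}},\quad \frac{\theta^3+s\theta^2+(s^2+a)\theta+s^3+as+b}{p^{\nu_1}},$$ where $\nu_1=\lfloor 2u_0/3\rfloor$, $\nu_2=\lfloor u_0/3\rfloor$ if $2u_0<3u_1$, and $\nu_1=\lfloor(\Delta-u_1)/2\rfloor$, $\nu_2=\lfloor u_1/2\rfloor$ if $2u_0\ge 3u_1$.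
   Context: $v_p$ is the $p$-adic valuation, $v_p(0)=\infty$. A $p$-integral basis of $K$ is a family of elements of $K$ that is a $\mathbb{Z}_{(p)}$-basis of $\mathbb{Z}_K\otimes_{\mathbb{Z}}\mathbb{Z}_{(p)}$, where $\mathbb{Z}_K$ is the ring of integers of $K$ and $\mathbb{Z}_{(p)}$ the localization of $\mathbb{Z}$ at $p$. Regular integers. For $s\in\mathbb{Z}$ write $f(x)=\sum_{i=0}^4 A_i(x-s)^i$, $A_i=f^{(i)}(s)/i!\in\mathbb{Z}$, and $w_i=v_p(A_i)$. Let $N^-_{x-s}(f)$ be the union of the sides of negative slope of the lower convex envelope of the points $(i,w_i)$, $0\le i\le4$, $w_i<\infty$. For an integer abscissa $i$ put $c_i=\overline{A_i/p^{w_i}}\in\mathbb{F}_p$ if $(i,w_i)$ lies on $N^-_{x-s}(f)$ and $c_i=0$ otherwise. A side of slope $-h/e$ ($h,e$ positive coprime), initial abscissa $i_0$ and horizontal length $de$ has residual polynomial $c_{i_0}+c_{i_0+e}y+\cdots+c_{i_0+de}y^d\in\mathbb{F}_p[y]$. The integer $s$ is regular if the residual polynomials of all sides of $N^-_{x-s}(f)$ are separable, and irregular otherwise. Iteration method. At an irregular integer $s$ (in the present situation) there is a unique side of $N^-_{x-s}(f)$ whose residual polynomial is inseparable; its slope is $-\mu$ with $\mu$ a positive integer, and its residual polynomial has a unique multiple root, which lies in $\mathbb{F}_p$. Choose any integer $y$ reducing to this root and replace $s$ by $s+yp^{\mu}$. Repeat this step until a regular integer is obtained; this happens after finitely many steps.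 *)

(* Defs.v *)
From HB Require Import structures.
From mathcomp Require Import all_boot all_order all_algebra all_field.
From mathcomp Require Import constructive_ereal.

Set Implicit Arguments.
Unset Strict Implicit.
Unset Printing Implicit Defensive.

Import Order.TTheory GRing.Theory Num.Theory.
Local Open Scope ring_scope.

(* [ordp p m] is the valuation of a nonzero [m] (it is 0 at [m = 0]);
   [vp p m] is the valuation with value [+oo] at 0. *)
Definition ordp (p : nat) (m : int) : nat := logn p `|m|%N.

Definition vp (p : nat) (m : int) : \bar rat :=
  if m == 0 then +oo%E else ((ordp p m)%:R)%:E.

(* The exact quotient m / p^(v_p(m)) for nonzero [m]. *)
Definition unit_part (p : nat) (m : int) : int :=
  (m %/ (p%:Z ^+ ordp p m))%Z.

(* Discriminant of a MONIC polynomial. *)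
Definition disc (f : {poly int}) : int :=
  (-1) ^+ 'C((size f).-1, 2) * resultant f f^`().

(* f(x) = \sum_i (taylor f s i) (x - s)^i, with taylor f s i = f^(i)(s) / i! *)
Definition taylor (f : {poly int}) (s : int) (i : nat) : int := f^`N(i).[s].

Section NewtonPolygon.
Variables (p : nat) (f : {poly int}) (s : int).

(* only used where taylor f s i != 0 *)
Definition ordinate (i : nat) : rat := (ordp p (taylor f s i))%:R.

Definition slope (i j : nat) : rat := (ordinate j - ordinate i) / (j%:R - i%:R).

Definition line (i j k : nat) : rat :=
  ordinate i + slope i j * (k%:R - i%:R).

(* Below, w_k stands for v_p(taylor f s k).
   The segment from (i, w_i) to (j, w_j) is a side of negative slope of the
   lower convex envelope of the points (k, w_k), w_k < oo: no point is below
   the line through these two points, and those on the line have abscissa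
   between i and j. *)
Definition is_side (i j : 'I_5) : bool :=
  [&& (i < j)%N, taylor f s i != 0, taylor f s j != 0, slope i j < 0 &
      [forall k : 'I_5, (taylor f s k != 0) ==>
         (line i j k <= ordinate k) &&
         ((ordinate k == line i j k) ==> (i <= k <= j)%N)]].

Definition on_polygon (k : nat) : bool :=
  (taylor f s k != 0) &&
  [exists i : 'I_5, exists j : 'I_5,
     [&& is_side i j, (i <= k <= j)%N & ordinate k == line i j k]].

Definition polygon_coef (k : nat) : 'F_p :=
  if on_polygon k then (unit_part p (taylor f s k))%:~R else 0.

(* [slope i j] is -h/e in lowest terms and j - i = d * e *)
Definition side_e (i j : nat) : nat := `|denq (slope i j)|%N.
Definition side_d (i j : nat) : nat := ((j - i) %/ side_e i j)%N.

Definition residual_poly (i j : nat) : {poly 'F_p} :=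
  \poly_(k < (side_d i j).+1) polygon_coef (i + k * side_e i j).

Definition regular_int : bool :=
  [forall i : 'I_5, forall j : 'I_5,
     is_side i j ==> separable_poly (residual_poly i j)].

End NewtonPolygon.

(* One step from an irregular integer [s]: on a side of slope -mu, mu a positive
   integer, choose an integer [y] reducing to a multiple root of the residual
   polynomial, and replace [s] by s + y p^mu. *)
Definition iteration_step (p : nat) (f : {poly int}) (s s' : int) : Prop :=
  exists (i j : 'I_5) (mu : nat) (y : int),
    [/\ is_side p f s i j,
        slope p f s i j = - mu%:R,
        (1 < mup (y%:~R : 'F_p) (residual_poly p f s i j))%N
      & s' = s + y * p%:Z ^+ mu].

(* [iteration_result p f s t]: starting from [s], the method may end with [t]. *)
Inductive iteration_result (p : nat) (f : {poly int}) : int -> int -> Prop :=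
| iteration_stop s : regular_int p f s -> iteration_result p f s s
| iteration_next s s' t :
    ~~ regular_int p f s -> iteration_step p f s s' ->
    iteration_result p f s' t -> iteration_result p f s t.

(* Whatever the choices made, the method never gets stuck at an irregular integer
   and reaches a regular one after finitely many steps. *)
Inductive iteration_terminates (p : nat) (f : {poly int}) : int -> Prop :=
| iteration_terminates_regular s :
    regular_int p f s -> iteration_terminates p f s
| iteration_terminates_irregular s :
    ~~ regular_int p f s ->
    (exists s', iteration_step p f s s') ->
    (forall s', iteration_step p f s s' -> iteration_terminates p f s') ->
    iteration_terminates p f s.

(* the localization of Z at p, inside Q *)
Definition Zloc (p : nat) (q : rat) : Prop := ~~ (p%:Z %| denq q)%Z.

(* Z_K tensored with the localization of Z at p, seen inside K: the elements x
   such that m x is an algebraic integer for some integer m prime to p. *)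
Definition int_closure_loc (p : nat) (K : fieldExtType rat) (x : K) : Prop :=
  exists2 m : int, ~~ (p%:Z %| m)%Z
    & integralOver (intr : int -> K) (m%:~R * x).

Definition pintegral_basis (p : nat) (K : fieldExtType rat) (n : nat)
    (w : n.-tuple K) : Prop :=
  (forall i, int_closure_loc p (tnth w i)) /\
  (forall x : K, int_closure_loc p x ->
     exists! c : {ffun 'I_n -> rat},
       (forall i, Zloc p (c i)) /\ x = \sum_i c i *: tnth w i).

(* Main.v *)
Require Import Defs.
From HB Require Import structures.
From mathcomp Require Import all_boot all_order all_algebra all_field.
From mathcomp Require Import constructive_ereal.
From mathcomp Require Import ring lra zify.

(** Write f in powers of x - s, with coefficients A_0, ..., A_3, 1, and let
    q_1, q_2, q_3 be the values at the root theta of the successive quotients of f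
    by x - s, of degrees 3, 2, 1. They satisfy t q_1 = - A_0, t q_2 = q_1 - A_1,
    t q_3 = q_2 - A_2, where t = theta - s, so their products are known integral
    combinations of them.

    Suppose A_2 = P b2, A_1 = P^2 h a1, A_0 = P^3 h^2 k0 with P and h powers of p.
    The relations show that the span of 1, q_3, q_2 / P and q_1 / (P^2 h) is
    a ring, hence consists of integral elements; and it contains theta. Since f has
    a simple root and a triple root mod p, over Z_p this ring is the product of Z_p
    and of the cubic ring attached to the binary cubic form
    (A_3 h, b2, a1, k0). The basis of the theorem is integral for this reason,
    the exponents nu_2 and nu_1 being those of P and of P^2 h.

    That nothing integral is missing at p is shown on elements: if y is in the ring
    and y / p is integral, then p divides the traces of y times each basis element.
    When the discriminant of the cubic form is prime to p this forces y to be in p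
    times the ring ([saturated_unramified]). The remaining cases are ramified, with
    a coefficient of the form exactly divisible by p; multiplying the few
    candidates for y / p by one another produces an integral element, such as
    q_3 / p, which the trace excludes ([saturated_ramified1], [saturated_ramified2]). The trace of an
    integral element is an integer because it is a sum of algebraic integers
    ([tr_Qint_of_root]).

    It remains to see that the Newton polygon leads to such a cubic form. The
    discriminant of f is A_3^2 P^6 h^2 times the one of the form, up to terms of
    higher valuation ([quartic_disc_scaled]). Hence the assumption on v(f''(s0)/2)
    places the point of abscissa 2 strictly above the polygon ([point2_above_of_disc]); at s0
    only the side from 0 to 3 can be inseparable, with residual polynomial
    A_3 y^3 + c_1 y + c_0, and its discriminant gives part (1). A step of the
    iteration creates a vertex at abscissa 2 which stays in place
    ([cubic_step], [quad_step]), each further step makes the first side steeper, and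
    the discriminant bounds its slope ([iterate_bound]). At a regular integer
    the possible shapes of the polygon are examined in [closed_order_steep],
    [closed_order_flat] and [closed_order_iterate]; the same computation of the
    discriminant identifies the exponents with the floors in the statement. *)

Set Implicit Arguments.
Unset Strict Implicit.
Unset Printing Implicit Defensive.

Import Order.TTheory GRing.Theory Num.Theory.
Local Open Scope ring_scope.

(** * Valuations of integers *)

Section Valuation.
Variable p : nat.
Hypothesis pp : prime p.

Lemma Euclid_dvdzM (m n : int) : (p%:Z %| m * n)%Z = (p%:Z %| m)%Z || (p%:Z %| n)%Z.
Proof. by rewrite !dvdzE abszM Euclid_dvdM. Qed.

Lemma ndvdzM (m n : int) :
  ~~ (p%:Z %| m)%Z -> ~~ (p%:Z %| n)%Z -> ~~ (p%:Z %| m * n)%Z.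
Proof. by rewrite Euclid_dvdzM negb_or => -> ->. Qed.

Lemma dvdz_ordp (z : int) k : z != 0 -> (p%:Z ^+ k %| z)%Z = (k <= ordp p z)%N.
Proof. by move=> z0; rewrite dvdzE abszX absz_nat pfactor_dvdn // absz_gt0. Qed.

Lemma unit_partE (z : int) : unit_part p z * p%:Z ^+ ordp p z = z.
Proof.
have [->|z0] := eqVneq z 0; first by rewrite /unit_part div0z mul0r.
by rewrite /unit_part divzK // dvdz_ordp.
Qed.

Let pX0 k : p%:Z ^+ k != 0.
Proof. by rewrite expf_neq0 // eqz_nat -lt0n prime_gt0. Qed.

Lemma unit_part_ndvd (z : int) : z != 0 -> ~~ (p%:Z %| unit_part p z)%Z.
Proof.
move=> z0; apply/negP => /dvdzP [m em].
have : (p%:Z ^+ (ordp p z).+1 %| z)%Z.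
  by rewrite -[X in (_ %| X)%Z]unit_partE em exprS -mulrA dvdz_mull.
by rewrite dvdz_ordp // ltnn.
Qed.

Lemma ordp_eq (m : int) k : ~~ (p%:Z %| m)%Z -> ordp p (m * p%:Z ^+ k) = k.
Proof.
move=> pm; have m0 : m != 0 by apply: contra pm => /eqP ->; rewrite dvdz0.
have z0 : m * p%:Z ^+ k != 0 by rewrite mulf_neq0.
apply/eqP; rewrite eqn_leq -dvdz_ordp // ?dvdz_mull ?andbT //= leqNgt -dvdz_ordp //.
by apply: contra pm; rewrite exprS dvdz_mul2r.
Qed.

Lemma unit_part_eq (m : int) k : ~~ (p%:Z %| m)%Z -> unit_part p (m * p%:Z ^+ k) = m.
Proof. by move=> pm; rewrite /unit_part ordp_eq // mulzK. Qed.

End Valuation.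

(** * The discriminant of a quartic *)

(** [bump], by structural recursion, so that indices of iterated minors
    compute to numerals. *)
Fixpoint skip (j k : nat) : nat :=
  match j, k with
  | 0, _ => k.+1
  | _, 0 => 0%N
  | j'.+1, k'.+1 => (skip j' k').+1
  end.

Lemma skipE j k : skip j k = bump j k.
Proof.
by elim: j k => [|j IH] [|k] //=; rewrite IH /bump ltnS addnS.
Qed.

Section SparseDet.
Variable R : comNzRingType.

(** A zero entry is [None], so that an expansion into minors drops it by
    computation; the 7 x 7 Sylvester matrix below then expands into few enough
    terms to be normalised symbolically. *)
Definition entry (o : option R) : R := if o is Some x then x else 0.

(** Laplace expansion along a row, over the columns j, ..., j + m - 1; the
    boolean is the sign of the current term. *)
Fixpoint alt_sum (b : bool) (m j : nat) (a : nat -> option R) (d : nat -> R) : R :=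
  match m with
  | 0 => 0
  | m'.+1 =>
      match a j with
      | None => alt_sum (~~ b) m' j.+1 a d
      | Some x => (if b then - (x * d j) else x * d j)
                    + alt_sum (~~ b) m' j.+1 a d
      end
  end.

Fixpoint sparse_det (n : nat) (F : nat -> nat -> option R) : R :=
  match n with
  | 0 => 1
  | n'.+1 => alt_sum false n'.+1 0 (F 0%N)
               (fun j => sparse_det n' (fun i k => F i.+1 (skip j k)))
  end.

Lemma alt_sumE b m j a d :
  alt_sum b m j a d =
  \sum_(l < m) (-1) ^+ (b + l)%N * entry (a (j + l)%N) * d (j + l)%N.
Proof.
elim: m b j => [|m IH] b j /=; first by rewrite big_ord0.
rewrite big_ord_recl /= !addn0 IH.
have -> : \sum_(l < m) (-1) ^+ (~~ b + l)%N * entry (a (j.+1 + l)%N) * d (j.+1 + l)%N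
   = \sum_(l < m) (-1) ^+ (b + bump 0 l)%N * entry (a (j + bump 0 l)%N) * d (j + bump 0 l)%N.
  apply: eq_bigr => l _; rewrite /bump /= add1n !addnS addSn.
  congr (_ * _ * _); rewrite -signr_odd -[RHS]signr_odd oddS !oddD.
  by case: b; case: (odd l).
by case: (a j) => [x|] /=; case: b; rewrite ?expr1 ?expr0 ?mulN1r ?mul1r ?mulNr ?mulr0 ?mul0r ?oppr0 ?add0r.
Qed.

Lemma sparse_detE n (F : nat -> nat -> option R) :
  \det (\matrix_(i < n, j < n) entry (F i j)) = sparse_det n F.
Proof.
elim: n F => [|n IH] F; first by rewrite det_mx00.
rewrite (expand_det_row _ ord0) [RHS]alt_sumE.
apply: eq_bigr => j _; rewrite mxE /cofactor !add0n.
rewrite -[X in _ = _ * X]IH mulrCA mulrA; congr (_ * \det _).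
by apply/matrixP=> i k; rewrite !mxE /= skipE.
Qed.
End SparseDet.

Definition quartic (a b c : int) : {poly int} :=
  'X^4 + a%:P * 'X^2 + b%:P * 'X + c%:P.

Lemma quarticE a b c : quartic a b c = Poly [:: c; b; a; 0; 1].
Proof.
rewrite /quartic /= !cons_poly_def; ring.
Qed.

Lemma size_quartic a b c : size (quartic a b c) = 5%N.
Proof. by rewrite quarticE (@PolyK _ 0). Qed.

Lemma deriv_quarticE a b c : (quartic a b c)^`() = Poly [:: b; 2 * a; 0; 4].
Proof.
rewrite quarticE; apply/polyP => i; rewrite coef_deriv !coef_Poly.
by case: i => [|[|[|[|[|i]]]]] //=; rewrite ?mulr1n ?mul0rn // mulr_natl.
Qed.

Lemma disc_quarticE a b c : disc (quartic a b c) =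
  16 * a ^+ 4 * c - 4 * a ^+ 3 * b ^+ 2 - 128 * a ^+ 2 * c ^+ 2
  + 144 * a * b ^+ 2 * c - 27 * b ^+ 4 + 256 * c ^+ 3.
Proof.
rewrite /disc size_quartic /= -signr_odd expr0 mul1r.
rewrite deriv_quarticE quarticE.
set f := Poly _; set g := Poly _.
have fE : f = [:: c; b; a; 0; 1] :> seq int by rewrite (@PolyK _ 0).
have gE : g = [:: b; 2 * a; 0; 4] :> seq int by rewrite (@PolyK _ 0).
pose F (i j : nat) : option int := nth None (nth [::] [::
  [:: Some c; Some b; Some a; None; Some 1; None; None];
  [:: None; Some c; Some b; Some a; None; Some 1; None];
  [:: None; None; Some c; Some b; Some a; None; Some 1];
  [:: Some b; Some (2 * a); None; Some 4; None; None; None];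
  [:: None; Some b; Some (2 * a); None; Some 4; None; None];
  [:: None; None; Some b; Some (2 * a); None; Some 4; None];
  [:: None; None; None; Some b; Some (2 * a); None; Some 4]] i) j.
have -> : resultant f g = \det (\matrix_(i < 7, j < 7) entry (F i j)).
  rewrite /resultant.
  have sf : size f = 5%N by rewrite fE.
  have sg : size g = 4%N by rewrite gE.
  have S (i j : 'I_((size g).-1 + (size f).-1)) : Sylvester_mx f g i j = entry (F i j).
    have s7 : ((size g).-1 + (size f).-1 = 7)%N by rewrite sf sg.
    have hj : (j < 7)%N by rewrite -s7 ltn_ord.
    rewrite Sylvester_mxE; case: splitP => k ik.
      have hk : (k < 3)%N by apply: leq_trans (ltn_ord k) _; rewrite sg.
      move: (nat_of_ord i) (nat_of_ord k) (nat_of_ord j) ik hk hj => i' k' j' ->.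
      rewrite fE; move: k' j'.
      by do 4?[case=> //]; do 8?[case=> //].
    have hk : (k < 4)%N by apply: leq_trans (ltn_ord k) _; rewrite sf.
    move: (nat_of_ord i) (nat_of_ord k) (nat_of_ord j) ik hk hj => i' k' j' ->.
    rewrite sg gE; move: k' j'.
    by do 5?[case=> //]; do 8?[case=> //].
  move: (Sylvester_mx f g) S; rewrite sf sg /= => M S.
  by congr (\det _); apply/matrixP => i j; rewrite S mxE.
rewrite sparse_detE.
cbv [sparse_det alt_sum F nth skip negb].
ring.
Qed.

(** * Traces of integral elements *)

(** The eigenvalues of [L] are roots of its minimal polynomial, hence of [h], so
    they are algebraic integers; the trace is their sum and is rational. *)
Lemma tr_Qint_of_root n (L : 'M[rat]_n.+1) (h : {poly int}) :
  h \is monic -> horner_mx L (map_poly intr h) = 0 -> \tr L \is a Num.int.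
Proof.
move=> mh hL0; pose LC := map_mx (ratr : rat -> algC) L.
have hLC0 : horner_mx LC (map_poly intr h) = 0.
  have -> : map_poly intr h = map_poly (ratr : rat -> algC) (map_poly intr h).
    by rewrite -map_poly_comp; apply: eq_map_poly => z /=; rewrite ratr_int.
  by rewrite -map_horner_mx hL0 map_mx0.
have [r Er] := closed_field_poly_normal (char_poly LC).
rewrite (monicP (char_poly_monic _)) scale1r in Er.
have rAint z : z \in r -> z \in Aint.
  move=> zr; have : root (char_poly LC) z by rewrite Er root_prod_XsubC.
  rewrite -eigenvalue_root_char eigenvalue_root_min => rz.
  apply: (@root_monic_Aint (map_poly intr h)).
  - by have /dvdpP [q ->] := mxminpoly_min hLC0; rewrite rootM rz orbT.
  - exact: monic_map.
  - by apply/polyOverP => i; rewrite coef_map /= intr_int.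
have sr : size r = n.+1.
  by move: (size_char_poly LC); rewrite Er size_prod_XsubC => -[].
have trE : \sum_(z <- r) z = ratr (\tr L).
  rewrite -trace_map_mx -/LC -[RHS]opprK -char_poly_trace // Er -[in RHS]sr.
  by rewrite coefPn_prod_XsubC ?opprK // sr.
have : ratr (\tr L) \is a (@Num.int algC).
  apply: Cint_rat_Aint; first exact: Crat_rat.
  by rewrite -trE big_seq rpred_sum.
move=> /intrP [z]; rewrite -(ratr_int _ z) => /fmorph_inj ->.
exact: intr_int.
Qed.

Lemma alg_int (K : fieldExtType rat) (z : int) : in_alg K z%:~R = z%:~R.
Proof. exact: (rmorph_int (in_alg K)). Qed.

Lemma intrK_eq0 (K : fieldExtType rat) (z : int) : (z%:~R == 0 :> K) = (z == 0).
Proof. by rewrite -alg_int fmorph_eq0 intr_eq0. Qed.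

(** In this section [w] is a column of elements of [K] independent over the
    rationals: a rational matrix is then determined by its effect on [w]. *)
Section Trace.
Variables (K : fieldExtType rat) (n : nat) (w : 'cV[K]_n.+1).
Hypothesis w_free : forall r : 'rV[rat]_n.+1, map_mx (in_alg K) r *m w = 0 -> r = 0.

Lemma horner_mx_eigen (L : 'M[K]_n.+1) (x : K) (g : {poly K}) :
  L *m w = x *: w -> horner_mx L g *m w = g.[x] *: w.
Proof.
move=> Lw; elim/poly_ind: g => [|g c IH].
  by rewrite rmorph0 horner0 scale0r mul0mx.
rewrite rmorphD rmorphM /= horner_mx_X horner_mx_C mulmxDl mul_scalar_mx.
by rewrite -mulmxA Lw -scalemxAr IH scalerA !hornerE scalerDl mulrC.
Qed.

Lemma tr_Qint_of_integral (L : 'M[rat]_n.+1) (x : K) :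
  map_mx (in_alg K) L *m w = x *: w -> integralOver (intr : int -> K) x ->
  \tr L \is a Num.int.
Proof.
move=> Lw [h mh rx]; apply: (tr_Qint_of_root mh).
apply/row_matrixP => i; rewrite row0; apply: w_free.
rewrite map_row -row_mul map_horner_mx (horner_mx_eigen _ Lw).
have -> : map_poly (in_alg K) (map_poly intr h) = map_poly intr h.
  by rewrite -map_poly_comp; apply: eq_map_poly => z; apply: alg_int.
by rewrite (rootP rx) scale0r row0.
Qed.

(** The numerical form in which integrality of traces is used: [N] represents
    multiplication by [p * x], so [tr N] is [p] times the trace of [x]. *)
Lemma dvd_tr_of_closure (p : nat) (N : 'M[int]_n.+1) (x : K) :
  prime p -> map_mx intr N *m w = (p%:R * x) *: w -> int_closure_loc p x ->
  (p%:Z %| \tr N)%Z.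
Proof.
move=> pp Nw [m pm mx].
have p0 : p%:R != 0 :> rat by rewrite pnatr_eq0 -lt0n prime_gt0.
have : \tr ((m%:~R / p%:R) *: map_mx intr N) \is a (@Num.int rat).
  apply: tr_Qint_of_integral mx.
  rewrite map_mxZ -scalemxAl -map_mx_comp.
  have -> : map_mx (in_alg K \o intr) N = map_mx intr N.
    by apply/matrixP => i j; rewrite !mxE; apply: alg_int.
  rewrite Nw scalerA; congr (_ *: _).
  have E : in_alg K (m%:~R / p%:R) = m%:~R / p%:R.
    rewrite fmorph_div; congr (_ / _); first exact: alg_int.
    exact: (rmorph_nat (in_alg K)).
  rewrite [X in X * _]E mulrA divfK //.
  by rewrite pmulrn intrK_eq0 eqz_nat -lt0n prime_gt0.
rewrite mxtraceZ trace_map_mx => /intrP [z /eqP].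
rewrite mulrAC -(inj_eq (mulIf p0)) divfK // pmulrn -!intrM eqr_int => /eqP E.
have : (p%:Z %| m * \tr N)%Z by rewrite E dvdz_mull.
rewrite Gauss_dvdzr //.
by rewrite coprimezE absz_nat prime_coprime.
Qed.
End Trace.

Section LocalClosure.
Variables (p : nat) (K : fieldExtType rat).
Hypothesis pp : prime p.
Local Notation O := (@int_closure_loc p K).

Lemma closure_integral x : integralOver (intr : int -> K) x -> O x.
Proof.
move=> ix; exists 1; last by rewrite mul1r.
by rewrite dvdzE dvdn1 neq_ltn prime_gt1 ?orbT.
Qed.

Lemma closure_int (m : int) : O m%:~R.
Proof. exact/closure_integral/integral_id. Qed.

Lemma closureM x y : O x -> O y -> O (x * y).
Proof.
move=> [m pm ix] [n pn iy]; exists (m * n); first exact: ndvdzM.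
by rewrite intrM mulrACA; apply: integral_mul.
Qed.

Lemma closureD x y : O x -> O y -> O (x + y).
Proof.
move=> [m pm ix] [n pn iy]; exists (m * n); first exact: ndvdzM.
have -> : (m * n)%:~R * (x + y) = n%:~R * (m%:~R * x) + m%:~R * (n%:~R * y).
  by rewrite intrM; ring.
by apply: integral_add; apply: integral_mul => //; apply: integral_id.
Qed.

Lemma closureB x y : O x -> O y -> O (x - y).
Proof.
move=> Ox Oy; apply: closureD => //.
by rewrite -mulN1r -(intrN _ 1); apply/closureM/Oy/closure_int.
Qed.

Lemma closure_cancel (m : int) x : ~~ (p%:Z %| m)%Z -> O (m%:~R * x) -> O x.
Proof.
move=> pm [n pn ix]; exists (n * m); first exact: ndvdzM.
by rewrite intrM -mulrA.
Qed.
End LocalClosure.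

(** * A family of quartic orders and their saturation at p *)

(** Linear algebra of the trace form mod p. The hypotheses say that the traces
    of y e1, y e2, y e3 and y vanish, for y = n1 e1 + n2 e2 + n3 e3 + n4.
    Modulo p the order splits as F_p times a cubic algebra; eliminating n4 and n3
    leaves on (n1, n2) the Hessian of the cubic form attached to that algebra. *)
Lemma hessian_kernel (F : fieldType) (A3 b2 a1 k0 h P n1 n2 n3 n4 : F) :
  (6 : F) != 0 -> A3 != 0 ->
  P * h * k0 = 0 -> P * h * a1 = 0 -> P * b2 = 0 ->
  a1 * (n1 * a1 + n2 * b2 + n3 * A3 + n4) + 2 * b2 * (- n1 * k0)
    + 3 * A3 * (- n2 * h * k0) - 4 * (n3 * P * h * k0) = 0 ->
  a1 * (n1 * b2 + n2 * A3 * h + n3 * P * h) + 2 * b2 * (n2 * b2 + n3 * A3 + n4)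
    + 3 * A3 * (- n1 * h * k0 - n2 * h * a1)
    + 4 * (- n2 * P * h ^+ 2 * k0 - n3 * P * h * a1) = 0 ->
  a1 * (n1 * A3 + n2 * P * h) + 2 * b2 * (n2 * A3 + n3 * P)
    + 3 * A3 * (n3 * A3 + n4)
    + 4 * (- n1 * P * h * k0 - n2 * P * h * a1 - n3 * P * b2) = 0 ->
  a1 * n1 + 2 * b2 * n2 + 3 * A3 * n3 + 4 * n4 = 0 ->
  [/\ n4 = 0,
      a1 * n1 + 2 * b2 * n2 + 3 * A3 * n3 = 0,
      2 * (a1 ^+ 2 - 3 * k0 * b2) * n1 + (a1 * b2 - 9 * A3 * h * k0) * n2 = 0
    & (a1 * b2 - 9 * A3 * h * k0) * n1
        + 2 * (b2 ^+ 2 - 3 * A3 * h * a1) * n2 = 0].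
Proof.
move=> n6 A30 Phk Pha Pb E1 E2 E3 E4.
have n40 : n4 = 0.
  apply: (mulfI A30); rewrite mulr0.
  set l3 := (X in X = 0) in E3; set l4 := (X in X = 0) in E4.
  have -> : A3 * n4 = A3 * l4 - l3 - 3 * n2 * (P * h * a1) - 2 * n3 * (P * b2)
                      - 4 * n1 * (P * h * k0).
    by rewrite /l3 /l4; ring.
  by rewrite E3 E4 Phk Pha Pb; ring.
have S : a1 * n1 + 2 * b2 * n2 + 3 * A3 * n3 = 0 by rewrite -E4 n40; ring.
split=> //.
  set l1 := (X in X = 0) in E1; set s := (X in X = 0) in S.
  have -> : 2 * (a1 ^+ 2 - 3 * k0 * b2) * n1 + (a1 * b2 - 9 * A3 * h * k0) * n2
    = 3 * l1 - a1 * s + 12 * n3 * (P * h * k0) - 3 * a1 * n4 by rewrite /l1 /s; ring.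
  by rewrite E1 S Phk n40; ring.
set l2 := (X in X = 0) in E2; set s := (X in X = 0) in S.
have -> : (a1 * b2 - 9 * A3 * h * k0) * n1 + 2 * (b2 ^+ 2 - 3 * A3 * h * a1) * n2
  = 3 * l2 - 2 * b2 * s + 9 * n3 * (P * h * a1) + 12 * n2 * h * (P * h * k0)
    - 6 * b2 * n4 by rewrite /l2 /s; ring.
by rewrite E2 S Phk Pha n40; ring.
Qed.

(** The discriminant of the binary cubic form
    x X^3 + y X^2 Y + z X Y^2 + t Y^3. *)
Definition cubic_disc (R : comNzRingType) (x y z t : R) : R :=
  y ^+ 2 * z ^+ 2 - 4 * x * z ^+ 3 - 4 * y ^+ 3 * t - 27 * x ^+ 2 * t ^+ 2
  + 18 * x * y * z * t.

(** Row i gives the coordinates of (n1 e1 + n2 e2 + n3 e3 + n4) times the i-th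
    element of the basis (e1, e2, e3, 1). *)
Definition mult_row (R : comNzRingType) (A3 b2 a1 k0 P h n1 n2 n3 n4 : R) : seq (seq R) :=
  [:: [:: n1 * a1 + n2 * b2 + n3 * A3 + n4; - n1 * k0; - n2 * h * k0; - n3 * P * h * k0];
      [:: n1 * b2 + n2 * A3 * h + n3 * P * h; n2 * b2 + n3 * A3 + n4;
          - n1 * h * k0 - n2 * h * a1; - n2 * P * h ^+ 2 * k0 - n3 * P * h * a1];
      [:: n1 * A3 + n2 * P * h; n2 * A3 + n3 * P; n3 * A3 + n4;
          - n1 * P * h * k0 - n2 * P * h * a1 - n3 * P * b2];
      [:: n1; n2; n3; n4]].

Lemma char_poly_tr (R : comNzRingType) n (A : 'M[R]_n) : char_poly A^T = char_poly A.
Proof.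
by rewrite /char_poly -det_tr /char_poly_mx linearB /= tr_scalar_mx map_trmx trmxK.
Qed.

(** The order Z e1 + Z e2 + Z e3 + Z with the multiplication table below. With
    q1, q2, q3 the successive quotients of f by x - s, evaluated at a root of f,
    one has e1 = q1 / (P^2 h), e2 = q2 / P, e3 = q3, when the Taylor coefficients
    of f at s are A3, P b2, P^2 h a1, P^3 h^2 k0. Away from the simple root of f
    mod p this is the cubic ring attached by Delone and Faddeev to the form
    (A3 h, b2, a1, k0). *)
Section Order.
Variables (p : nat) (K : fieldExtType rat) (e1 e2 e3 : K).
Variables (A3 b2 a1 k0 P h : int).
Hypothesis pp : prime p.
Hypothesis M11 : e1 * e1 = a1%:~R * e1 - k0%:~R * e2.
Hypothesis M12 : e1 * e2 = b2%:~R * e1 - (h * k0)%:~R * e3.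
Hypothesis M22 : e2 * e2 = (A3 * h)%:~R * e1 + b2%:~R * e2 - (h * a1)%:~R * e3
                           - (P * h ^+ 2 * k0)%:~R.
Hypothesis M13 : e1 * e3 = A3%:~R * e1 - (P * h * k0)%:~R.
Hypothesis M23 : e2 * e3 = (P * h)%:~R * e1 + A3%:~R * e2 - (P * h * a1)%:~R.
Hypothesis M33 : e3 * e3 = P%:~R * e2 + A3%:~R * e3 - (P * b2)%:~R.
Hypothesis free4 : forall c1 c2 c3 c4 : rat,
  c1 *: e1 + c2 *: e2 + c3 *: e3 + c4 *: 1 = 0 -> [/\ c1 = 0, c2 = 0, c3 = 0 & c4 = 0].

Local Notation O := (@int_closure_loc p K).

Definition elt (n1 n2 n3 n4 : int) : K :=
  n1%:~R * e1 + n2%:~R * e2 + n3%:~R * e3 + n4%:~R.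

Definition basis_col : 'cV[K]_4 := \col_i nth 0 [:: e1; e2; e3; 1] i.

Definition mult_mx (n1 n2 n3 n4 : int) : 'M[int]_4 :=
  \matrix_(i, j) nth 0 (nth [::] (mult_row A3 b2 a1 k0 P h n1 n2 n3 n4) i) j.

Lemma mult_mxE n1 n2 n3 n4 :
  map_mx intr (mult_mx n1 n2 n3 n4) *m basis_col = elt n1 n2 n3 n4 *: basis_col.
Proof.
apply/matrixP => i j; rewrite !mxE !big_ord_recl big_ord0 !mxE /elt /=.
case: i => [[|[|[|[|i]]]]] // _ /=.
- ring: M11 M12 M13.
- ring: M12 M22 M23.
- ring: M13 M23 M33.
- ring.
Qed.

Lemma basis_col_free (r : 'rV[rat]_4) : map_mx (in_alg K) r *m basis_col = 0 -> r = 0.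
Proof.
move/matrixP/(_ 0 0); rewrite !mxE !big_ord_recl big_ord0 !mxE /=.
rewrite !mulr_algl addr0 !addrA => /free4 [r0 r1 r2 r3].
apply/matrixP => i j; rewrite (ord1 i) mxE.
case: j => [[|[|[|[|j]]]] // hj].
- by rewrite -[RHS]r0; congr (r _ _); apply: val_inj.
- by rewrite -[RHS]r1; congr (r _ _); apply: val_inj.
- by rewrite -[RHS]r2; congr (r _ _); apply: val_inj.
- by rewrite -[RHS]r3; congr (r _ _); apply: val_inj.
Qed.

(** Multiplication by the element preserves the lattice spanned by the basis, so
    the element is a root of the characteristic polynomial of an integer matrix. *)
Lemma elt_integral n1 n2 n3 n4 : integralOver (intr : int -> K) (elt n1 n2 n3 n4).
Proof.
exists (char_poly (mult_mx n1 n2 n3 n4)); first exact: char_poly_monic.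
rewrite map_char_poly /= -char_poly_tr -eigenvalue_root_char.
apply/eigenvalueP; exists basis_col^T.
  by rewrite -trmx_mul mult_mxE linearZ.
apply/eqP => /matrixP /(_ 0 ord_max); rewrite !mxE /=.
by apply/eqP; rewrite oner_eq0.
Qed.


Local Notation frac n1 n2 n3 n4 := (elt n1 n2 n3 n4 / p%:R).

Let pK0 : p%:R != 0 :> K.
Proof. by rewrite pmulrn intrK_eq0 eqz_nat -lt0n prime_gt0. Qed.

Definition tr_form (n1 n2 n3 n4 : int) : int :=
  a1 * n1 + 2 * b2 * n2 + 3 * A3 * n3 + 4 * n4.

Lemma tr_form_dvd n1 n2 n3 n4 : O (frac n1 n2 n3 n4) -> (p%:Z %| tr_form n1 n2 n3 n4)%Z.
Proof.
move=> Ox.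
have <- : \tr (mult_mx n1 n2 n3 n4) = tr_form n1 n2 n3 n4.
  rewrite /mxtrace !big_ord_recl big_ord0 !mxE /= /tr_form; ring.
apply: dvd_tr_of_closure Ox => //; first exact: basis_col_free.
by rewrite mulrC divfK // mult_mxE.
Qed.

Definition row_elt n1 n2 n3 n4 i : K :=
  let r := nth [::] (mult_row A3 b2 a1 k0 P h n1 n2 n3 n4) i in
  elt (nth 0 r 0) (nth 0 r 1) (nth 0 r 2) (nth 0 r 3).

Lemma mul_eltE n1 n2 n3 n4 :
  [/\ elt n1 n2 n3 n4 * e1 = row_elt n1 n2 n3 n4 0,
      elt n1 n2 n3 n4 * e2 = row_elt n1 n2 n3 n4 1 &
      elt n1 n2 n3 n4 * e3 = row_elt n1 n2 n3 n4 2].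
Proof.
rewrite /row_elt /elt /=; split.
- ring: M11 M12 M13.
- ring: M12 M22 M23.
- ring: M13 M23 M33.
Qed.

Let O_e1 : O e1.
Proof.
have := elt_integral 1 0 0 0; rewrite /elt mul1r !mul0r !addr0.
exact: closure_integral.
Qed.
Let O_e2 : O e2.
Proof.
have := elt_integral 0 1 0 0; rewrite /elt mul1r !mul0r !addr0 add0r.
exact: closure_integral.
Qed.
Let O_e3 : O e3.
Proof.
have := elt_integral 0 0 1 0; rewrite /elt mul1r !mul0r !addr0 !add0r.
exact: closure_integral.
Qed.

Hypothesis p_gt3 : (3 < p)%N.
Hypothesis pA3 : ~~ (p%:Z %| A3)%Z.
Hypothesis pPhk : (p%:Z %| P * h * k0)%Z.
Hypothesis pPha : (p%:Z %| P * h * a1)%Z.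
Hypothesis pPb : (p%:Z %| P * b2)%Z.

Local Notation F := 'F_p.
Let dvdF (z : int) : (p%:Z %| z)%Z = (z%:~R == 0 :> F).
Proof. exact: dvdz_pcharf (pchar_Fp pp) z. Qed.

(** If y / p is integral, so are its products with e1, e2, e3: y lies in the
    radical of the trace form mod p. *)
Lemma trace_radical n1 n2 n3 n4 : O (frac n1 n2 n3 n4) ->
  [/\ (p%:Z %| n4)%Z, (p%:Z %| a1 * n1 + 2 * b2 * n2 + 3 * A3 * n3)%Z,
      (p%:Z %| 2 * (a1 ^+ 2 - 3 * k0 * b2) * n1 + (a1 * b2 - 9 * A3 * h * k0) * n2)%Z &
      (p%:Z %| (a1 * b2 - 9 * A3 * h * k0) * n1 + 2 * (b2 ^+ 2 - 3 * A3 * h * a1) * n2)%Z].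
Proof.
move=> Ox; have [r1 r2 r3] := mul_eltE n1 n2 n3 n4.
have E4 := tr_form_dvd Ox.
have E1 : O (row_elt n1 n2 n3 n4 0 / p%:R) by rewrite -r1 mulrAC; apply: closureM.
have E2 : O (row_elt n1 n2 n3 n4 1 / p%:R) by rewrite -r2 mulrAC; apply: closureM.
have E3 : O (row_elt n1 n2 n3 n4 2 / p%:R) by rewrite -r3 mulrAC; apply: closureM.
move/tr_form_dvd: E1; move/tr_form_dvd: E2; move/tr_form_dvd: E3; move: E4.
rewrite /tr_form /= !dvdF => /eqP E4 /eqP E3 /eqP E2 /eqP E1.
have [] := @hessian_kernel F A3%:~R b2%:~R a1%:~R k0%:~R h%:~R P%:~R
   n1%:~R n2%:~R n3%:~R n4%:~R.
- have : ~~ (p%:Z %| 6)%Z by rewrite dvdzE (Euclid_dvdM 2 3) // !gtnNdvd // ltnW.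
  by rewrite dvdF.
- by move: pA3; rewrite dvdF.
- by move: pPhk; rewrite dvdF !intrM => /eqP.
- by move: pPha; rewrite dvdF !intrM => /eqP.
- by move: pPb; rewrite dvdF !intrM => /eqP.
- by rewrite -[RHS]E1; ring.
- by rewrite -[RHS]E2; ring.
- by rewrite -[RHS]E3; ring.
- by rewrite -[RHS]E4; ring.
move=> H4 H3 H1 H2; split; apply/eqP; first exact: H4.
- by rewrite -[RHS]H3; ring.
- by rewrite -[RHS]H1; ring.
- by rewrite -[RHS]H2; ring.
Qed.


Let p_not2 : (p%:Z %| 2)%Z = false.
Proof. by rewrite dvdzE gtnNdvd // ltnW. Qed.
Let p_not3 : (p%:Z %| 3)%Z = false.
Proof. by rewrite dvdzE gtnNdvd. Qed.
Let EuclidE := (fun m n => Euclid_dvdzM pp m n).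

(** No element of the order becomes divisible by p in the integral closure;
    equivalently the index of the order in the maximal order is prime to p. *)
Definition saturated :=
  forall n1 n2 n3 n4, O (frac n1 n2 n3 n4) ->
  [/\ (p%:Z %| n1)%Z, (p%:Z %| n2)%Z, (p%:Z %| n3)%Z & (p%:Z %| n4)%Z].

(** Here the trace form is nondegenerate mod p: the determinant of the Hessian is
    three times the discriminant of the cubic form. *)
Lemma saturated_unramified :
  ~~ (p%:Z %| cubic_disc (A3 * h) b2 a1 k0)%Z -> saturated.
Proof.
move=> pD n1 n2 n3 n4 /trace_radical [p4 S H1 H2].
have p1 : (p%:Z %| n1)%Z.
  have : (p%:Z %| 3 * cubic_disc (A3 * h) b2 a1 k0 * n1)%Z.
    have -> : 3 * cubic_disc (A3 * h) b2 a1 k0 * n1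
      = (2 * (a1 ^+ 2 - 3 * k0 * b2) * n1 + (a1 * b2 - 9 * A3 * h * k0) * n2)
          * (2 * (b2 ^+ 2 - 3 * A3 * h * a1))
        - ((a1 * b2 - 9 * A3 * h * k0) * n1 + 2 * (b2 ^+ 2 - 3 * A3 * h * a1) * n2)
          * (a1 * b2 - 9 * A3 * h * k0) by rewrite /cubic_disc; ring.
    by rewrite rpredB // dvdz_mulr.
  by rewrite !EuclidE p_not3 (negPf pD).
have p2 : (p%:Z %| n2)%Z.
  have : (p%:Z %| 3 * cubic_disc (A3 * h) b2 a1 k0 * n2)%Z.
    have -> : 3 * cubic_disc (A3 * h) b2 a1 k0 * n2
      = ((a1 * b2 - 9 * A3 * h * k0) * n1 + 2 * (b2 ^+ 2 - 3 * A3 * h * a1) * n2)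
          * (2 * (a1 ^+ 2 - 3 * k0 * b2))
        - (2 * (a1 ^+ 2 - 3 * k0 * b2) * n1 + (a1 * b2 - 9 * A3 * h * k0) * n2)
          * (a1 * b2 - 9 * A3 * h * k0) by rewrite /cubic_disc; ring.
    by rewrite rpredB // dvdz_mulr.
  by rewrite !EuclidE p_not3 (negPf pD).
split=> //.
have : (p%:Z %| 3 * A3 * n3)%Z.
  have -> : 3 * A3 * n3 = (a1 * n1 + 2 * b2 * n2 + 3 * A3 * n3) - a1 * n1 - 2 * b2 * n2.
    by ring.
  by rewrite !rpredB // dvdz_mull.
by rewrite !EuclidE p_not3 (negPf pA3).
Qed.

Let frac_split n1 n2 n3 n4 : frac n1 n2 n3 n4
  = n1%:~R * (e1 / p%:R) + n2%:~R * (e2 / p%:R) + n3%:~R * (e3 / p%:R) + n4%:~R / p%:R.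
Proof. by rewrite /elt; ring. Qed.

Let fracE2 : frac 0 1 0 0 = e2 / p%:R. Proof. by rewrite frac_split; ring. Qed.
Let fracE3 : frac 0 0 1 0 = e3 / p%:R. Proof. by rewrite frac_split; ring. Qed.

(* The residual F_p factor of the order is unramified, so this is always the
   contradiction reached in the ramified cases. *)
Let e3_not_divisible : ~ O (e3 / p%:R).
Proof.
rewrite -fracE3 => /trace_radical [_ + _ _].
by rewrite !mulr0 !add0r mulr1 EuclidE p_not3 (negPf pA3).
Qed.

Let O_dvd (n : int) (x : K) : (p%:Z %| n)%Z -> O x -> O (n%:~R * (x / p%:R)).
Proof.
case/dvdzP => m -> Ox; have -> : (m * p%:Z)%:~R * (x / p%:R) = m%:~R * x.
  by rewrite intrM -pmulrn -mulrA; congr (_ * _); rewrite mulrCA divff ?mulr1.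
by apply: closureM => //; apply: closure_int.
Qed.

Let O_drop n1 n2 n3 n4 : (p%:Z %| n3)%Z -> (p%:Z %| n4)%Z -> O (frac n1 n2 n3 n4) ->
  O (n1%:~R * (e1 / p%:R) + n2%:~R * (e2 / p%:R)).
Proof.
move=> p3 p4; rewrite frac_split -(mulr1 n4%:~R) -mulrA => Ox.
have -> : n1%:~R * (e1 / p%:R) + n2%:~R * (e2 / p%:R)
  = n1%:~R * (e1 / p%:R) + n2%:~R * (e2 / p%:R) + n3%:~R * (e3 / p%:R)
    + n4%:~R * (1 / p%:R) - n3%:~R * (e3 / p%:R) - n4%:~R * (1 / p%:R) by ring.
apply: (closureB pp); last exact: O_dvd p4 (closure_int _ _ 1).
by apply: (closureB pp) => //; apply: O_dvd.
Qed.

(** The trace form only gives that an offending element is a multiple of e1, or a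
    combination of e1 and e2. The classical criterion for cubic rings then applies:
    a1 and k0 are divisible by p but k0 is not divisible by p^2. If e1 / p were
    integral, its square would make e2 / p integral, because k0 / p is a unit. The
    trace form excludes this when b2 is a unit; otherwise h is one, and the product
    of both would make e3 / p integral. *)
Lemma saturated_ramified1 :
  (p%:Z %| a1)%Z -> (p%:Z %| k0)%Z -> ~~ (p%:Z ^+ 2 %| k0)%Z ->
  ~~ (p%:Z %| b2)%Z || ~~ (p%:Z %| h)%Z -> saturated.
Proof.
move=> pa pk p2k form.
have [a ea] := dvdzP pa; have [k ek] := dvdzP pk.
have pk' : ~~ (p%:Z %| k)%Z.
  by apply: contra p2k => /dvdzP [k' ek']; rewrite ek ek' expr2 -mulrA dvdz_mull.
have coords n1 n2 n3 n4 : O (frac n1 n2 n3 n4) ->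
    [/\ (p%:Z %| b2 * n2)%Z, (p%:Z %| n3)%Z & (p%:Z %| n4)%Z].
  move=> /trace_radical [p4 S _ H2].
  have pb : (p%:Z %| b2 * n2)%Z.
    have : (p%:Z %| 2 * b2 * (b2 * n2))%Z.
      have -> : 2 * b2 * (b2 * n2) = ((a1 * b2 - 9 * A3 * h * k0) * n1
         + 2 * (b2 ^+ 2 - 3 * A3 * h * a1) * n2) - (b2 * n1 - 6 * A3 * h * n2) * a1
         + 9 * A3 * h * n1 * k0 by ring.
      by rewrite rpredD ?rpredB // dvdz_mull.
    by rewrite !EuclidE p_not2 /= => /orP [->|].
  split=> //.
  have : (p%:Z %| 3 * A3 * n3)%Z.
    have -> : 3 * A3 * n3
      = (a1 * n1 + 2 * b2 * n2 + 3 * A3 * n3) - n1 * a1 - 2 * (b2 * n2) by ring.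
    by rewrite !rpredB // dvdz_mull.
  by rewrite !EuclidE p_not3 (negPf pA3).
have e1_not : ~ O (e1 / p%:R).
  move=> O1.
  have O2 : O (e2 / p%:R).
    apply: (closure_cancel pp pk').
    have -> : k%:~R * (e2 / p%:R)
      = a%:~R * (e1 / p%:R) - (e1 / p%:R) * (e1 / p%:R).
      rewrite mulf_div M11 ea ek !intrM -!pmulrn; field; exact: pK0.
    by apply: (closureB pp); apply: (closureM pp) => //; apply: closure_int.
  have := O2; rewrite -fracE2 => /coords [pb _ _].
  rewrite mulr1 in pb; rewrite pb /= in form; have [b eb] := dvdzP pb.
  apply: e3_not_divisible; apply: (closure_cancel pp (ndvdzM pp form pk')).
  have -> : (h * k)%:~R * (e3 / p%:R)
    = b%:~R * (e1 / p%:R) - (e1 / p%:R) * (e2 / p%:R).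
    rewrite mulf_div M12 eb ek !intrM -!pmulrn; field; exact: pK0.
  by apply: (closureB pp); apply: (closureM pp) => //; apply: closure_int.
move=> n1 n2 n3 n4 Ox; have [pbn p3 p4] := coords _ _ _ _ Ox.
have O12 := O_drop p3 p4 Ox.
have p2 : (p%:Z %| n2)%Z.
  apply/negP => /negP p2; apply: e1_not.
  move: pbn; rewrite EuclidE (negPf p2) orbF => pb; rewrite pb /= in form.
  have [b eb] := dvdzP pb.
  (* multiplying by e2 turns the e2-component into an e1-component *)
  apply: (closure_cancel pp (ndvdzM pp p2 (ndvdzM pp pA3 form))).
  have -> : (n2 * (A3 * h))%:~R * (e1 / p%:R)
    = (n1%:~R * (e1 / p%:R) + n2%:~R * (e2 / p%:R)) * e2
      - elt (n1 * b) (n2 * b) (- n1 * h * k - n2 * h * a) (- n2 * P * h ^+ 2 * k).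
    rewrite /elt !(intrM, intrD, intrB, intrN).
    have -> : (n1%:~R * (e1 / p%:R) + n2%:~R * (e2 / p%:R)) * e2
      = n1%:~R * ((e1 * e2) / p%:R) + n2%:~R * ((e2 * e2) / p%:R) by ring.
    rewrite M12 M22 eb ek ea !intrM -!pmulrn; field; exact: pK0.
  apply: (closureB pp); first exact: closureM.
  exact/closure_integral/elt_integral.
split=> //; apply/negP => /negP p1; apply: e1_not; apply: (closure_cancel pp p1).
have -> : n1%:~R * (e1 / p%:R)
  = n1%:~R * (e1 / p%:R) + n2%:~R * (e2 / p%:R) - n2%:~R * (e2 / p%:R) by ring.
by apply: (closureB pp) => //; apply: O_dvd.
Qed.

(** The mirror image of the previous case, at the other end of the cubic form: e2
    takes the part of e1, and A3 h that of k0. *)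
Lemma saturated_ramified2 :
  (p%:Z %| b2)%Z -> (p%:Z %| h)%Z -> ~~ (p%:Z ^+ 2 %| h)%Z ->
  ~~ (p%:Z %| a1)%Z || ~~ (p%:Z %| k0)%Z -> saturated.
Proof.
move=> pb ph p2h form.
have [b eb] := dvdzP pb; have [g eg] := dvdzP ph.
have pg : ~~ (p%:Z %| g)%Z.
  by apply: contra p2h => /dvdzP [k' ek']; rewrite eg ek' expr2 -mulrA dvdz_mull.
have coords n1 n2 n3 n4 : O (frac n1 n2 n3 n4) ->
    [/\ (p%:Z %| a1 * n1)%Z, (p%:Z %| n3)%Z & (p%:Z %| n4)%Z].
  move=> /trace_radical [p4 S H1 _].
  have pa : (p%:Z %| a1 * n1)%Z.
    have : (p%:Z %| 2 * a1 * (a1 * n1))%Z.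
      have -> : 2 * a1 * (a1 * n1) = (2 * (a1 ^+ 2 - 3 * k0 * b2) * n1
         + (a1 * b2 - 9 * A3 * h * k0) * n2) + (6 * k0 * n1 - a1 * n2) * b2
         + 9 * A3 * k0 * n2 * h by ring.
      by apply: rpredD; [apply: rpredD => //|]; rewrite dvdz_mull.
    by rewrite !EuclidE p_not2 /= => /orP [->|].
  split=> //.
  have : (p%:Z %| 3 * A3 * n3)%Z.
    have -> : 3 * A3 * n3
      = (a1 * n1 + 2 * b2 * n2 + 3 * A3 * n3) - a1 * n1 - 2 * n2 * b2 by ring.
    by rewrite !rpredB // dvdz_mull.
  by rewrite !EuclidE p_not3 (negPf pA3).
have e2_not : ~ O (e2 / p%:R).
  move=> O2.
  have O13 : O (frac (A3 * g) 0 (- (g * a1)) 0).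
    have -> : frac (A3 * g) 0 (- (g * a1)) 0
      = (e2 / p%:R) * (e2 / p%:R) - b%:~R * (e2 / p%:R) + (P * g ^+ 2 * k0)%:~R.
      rewrite /elt mulf_div M22 eb eg; field; exact: pK0.
    apply: (closureD pp); last exact: closure_int.
    by apply: (closureB pp); apply: (closureM pp) => //; apply: closure_int.
  have [_ + _] := coords _ _ _ _ O13.
  rewrite rpredN EuclidE (negPf pg) /= => pa; rewrite pa /= in form.
  have [a ea] := dvdzP pa.
  have O1 : O (e1 / p%:R).
    apply: (closure_cancel pp (ndvdzM pp pA3 pg)).
    have -> : (A3 * g)%:~R * (e1 / p%:R)
      = frac (A3 * g) 0 (- (g * a1)) 0 + (g * a)%:~R * e3.
      rewrite /elt ea; field; exact: pK0.
    by apply: (closureD pp) => //; apply: (closureM pp) => //; apply: closure_int.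
  apply: e3_not_divisible; apply: (closure_cancel pp (ndvdzM pp pg form)).
  have -> : (g * k0)%:~R * (e3 / p%:R)
    = b%:~R * (e1 / p%:R) - (e1 / p%:R) * (e2 / p%:R).
    rewrite mulf_div M12 eb eg; field; exact: pK0.
  by apply: (closureB pp); apply: (closureM pp) => //; apply: closure_int.
move=> n1 n2 n3 n4 Ox; have [pan p3 p4] := coords _ _ _ _ Ox.
have O12 := O_drop p3 p4 Ox.
have p1 : (p%:Z %| n1)%Z.
  apply/negP => /negP p1; apply: e2_not.
  move: pan; rewrite EuclidE (negPf p1) orbF => pa; rewrite pa /= in form.
  have [a ea] := dvdzP pa.
  (* multiplying by e1 turns the e1-component into an e2-component *)
  apply: (closure_cancel pp (ndvdzM pp p1 form)).
  have -> : (n1 * k0)%:~R * (e2 / p%:R)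
    = elt (n1 * a + n2 * b) 0 (- n2 * g * k0) 0
      - (n1%:~R * (e1 / p%:R) + n2%:~R * (e2 / p%:R)) * e1.
    have -> : (n1%:~R * (e1 / p%:R) + n2%:~R * (e2 / p%:R)) * e1
      = n1%:~R * ((e1 * e1) / p%:R) + n2%:~R * ((e1 * e2) / p%:R) by ring.
    rewrite /elt M11 M12 eb eg ea; field; exact: pK0.
  apply: (closureB pp); last exact: closureM.
  exact/closure_integral/elt_integral.
split=> //; apply/negP => /negP p2; apply: e2_not; apply: (closure_cancel pp p2).
have -> : n2%:~R * (e2 / p%:R)
  = n1%:~R * (e1 / p%:R) + n2%:~R * (e2 / p%:R) - n1%:~R * (e1 / p%:R) by ring.
by apply: (closureB pp) => //; apply: O_dvd.
Qed.

Lemma elt_inj n1 n2 n3 n4 (c1 c2 c3 c4 : rat) :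
  c1 *: e1 + c2 *: e2 + c3 *: e3 + c4 *: 1 = elt n1 n2 n3 n4 ->
  [/\ c1 = n1%:~R, c2 = n2%:~R, c3 = n3%:~R & c4 = n4%:~R].
Proof.
rewrite /elt -!alg_int /= !mulr_algl => E.
have [] := @free4 (c1 - n1%:~R) (c2 - n2%:~R) (c3 - n3%:~R) (c4 - n4%:~R).
  by move/eqP: E; rewrite -subr_eq0 => /eqP <-; rewrite !scalerBl; ring.
by do 4!move/subr0_eq ->.
Qed.

(** A power of p in a common denominator can be removed one factor at a time. *)
Lemma closure_descent (m : int) N n1 n2 n3 n4 (x : K) :
  saturated -> O x -> (m * p%:Z ^+ N)%:~R * x = elt n1 n2 n3 n4 ->
  exists k1 k2 k3 k4, m%:~R * x = elt k1 k2 k3 k4.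
Proof.
move=> sat Ox; elim: N n1 n2 n3 n4 => [|N IH] n1 n2 n3 n4.
  by rewrite expr0 mulr1 => E; exists n1, n2, n3, n4.
rewrite exprSr mulrA => E.
have [] := sat n1 n2 n3 n4.
  rewrite -E.
  have -> : (m * p%:Z ^+ N * p%:Z)%:~R * x / p%:R = (m * p%:Z ^+ N)%:~R * x.
    by rewrite [(_ * p%:Z)%:~R]intrM -pmulrn; field; exact: pK0.
  by apply: (closureM pp) => //; apply: closure_int.
case/dvdzP => k1 ek1 /dvdzP [k2 ek2] /dvdzP [k3 ek3] /dvdzP [k4 ek4].
apply: (IH k1 k2 k3 k4); apply: (mulIf pK0).
have -> : (m * p%:Z ^+ N)%:~R * x * p%:R = (m * p%:Z ^+ N * p%:Z)%:~R * x.
  by field.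
by rewrite E /elt ek1 ek2 ek3 ek4 !intrM -!pmulrn; ring.
Qed.

Lemma Zloc_div (n m : int) : ~~ (p%:Z %| m)%Z -> Zloc p (n%:~R / m%:~R).
Proof.
move=> pm; rewrite /Zloc; set q := _ / _; apply/negP => pd.
have m0 : m%:~R != 0 :> rat.
  by rewrite intr_eq0; apply: contra pm => /eqP ->; rewrite dvdz0.
have E : numq q * m = n * denq q.
  apply/eqP; rewrite -(eqr_int rat) !intrM.
  have -> : n%:~R = q * m%:~R by rewrite divfK.
  by rewrite -{2}(divq_num_den q) mulrAC divfK ?intr_eq0 ?denq_neq0.
have : (p%:Z %| numq q * m)%Z by rewrite E dvdz_mull.
rewrite EuclidE (negPf pm) orbF => pn.
have := coprime_num_den q; rewrite /coprime => /eqP g1.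
have : (p %| gcdn `|numq q| `|denq q|)%N by move: pn pd; rewrite !dvdzE dvdn_gcd => -> ->.
by rewrite g1 dvdn1 => /eqP p1; move: p_gt3; rewrite p1.
Qed.

(** An integral x has rational coordinates with some common denominator m p^N,
    where p does not divide m; saturation brings N down to 0. *)
Lemma pintegral_basis_of_saturated (theta : K) (r : int) :
  e3 = theta + r%:~R ->
  (forall x : K, exists c1 c2 c3 c4 : rat,
     x = c1 *: e1 + c2 *: e2 + c3 *: e3 + c4 *: 1) ->
  saturated -> pintegral_basis p [tuple 1; theta; e2; e1].
Proof.
move=> e3E span sat; split.
  have Oth : O theta.
    have -> : theta = e3 - r%:~R by rewrite e3E addrK.
    by apply: (closureB pp) => //; apply: closure_int.
  case=> [[|[|[|[|i]]]]] // hi; rewrite (tnth_nth 0) //=.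
  exact: (@closure_int p K pp 1).
move=> x Ox; have [c1 [c2 [c3 [c4 xE]]]] := span x.
pose D : int := denq c1 * denq c2 * denq c3 * denq c4.
have D0 : D != 0 by rewrite !mulf_neq0 ?denq_neq0.
have [m pm [N DE]] : exists2 m : int, ~~ (p%:Z %| m)%Z & exists N, D = m * p%:Z ^+ N.
  by exists (unit_part p D); [apply: unit_part_ndvd | exists (ordp p D); rewrite unit_partE].
have Dc (c : rat) : (denq c %| D)%Z -> exists n : int, D%:~R * c = n%:~R.
  case/dvdzP => d ->; exists (d * numq c).
  by rewrite !intrM -mulrA [_%:~R * c]mulrC -{1}(divq_num_den c) divfK // intr_eq0 denq_neq0.
have [n1 e1n] : exists n : int, D%:~R * c1 = n%:~R.
  by apply: Dc; rewrite /D -!mulrA dvdz_mulr.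
have [n2 e2n] : exists n : int, D%:~R * c2 = n%:~R.
  by apply: Dc; rewrite /D mulrAC -mulrA mulrAC dvdz_mull.
have [n3 e3n] : exists n : int, D%:~R * c3 = n%:~R.
  by apply: Dc; rewrite /D mulrAC dvdz_mull.
have [n4 e4n] : exists n : int, D%:~R * c4 = n%:~R.
  by apply: Dc; rewrite /D dvdz_mull.
have [] := @closure_descent m N n1 n2 n3 n4 x sat Ox.
  rewrite -DE xE /elt -!alg_int -e1n -e2n -e3n -e4n /= !mulr_algl !scalerDr !scalerA.
  by [].
move=> k1 [k2 [k3 [k4 mxE]]].
have [] := @elt_inj k1 k2 k3 k4 (m%:~R * c1) (m%:~R * c2) (m%:~R * c3) (m%:~R * c4).
  by rewrite -mxE xE -alg_int /= mulr_algl !scalerDr !scalerA.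
have m0 : m%:~R != 0 :> rat.
  by rewrite intr_eq0; apply: contra pm => /eqP ->; rewrite dvdz0.
have cE (c : rat) (k : int) : m%:~R * c = k%:~R -> c = k%:~R / m%:~R.
  by move=> <-; rewrite mulrC mulKf.
move=> /cE c1E /cE c2E /cE c3E /cE c4E.
pose cs : 'I_4 -> rat := fun i => nth 0 [:: c4 + c3 * r%:~R; c3; c2; c1] i.
have sumE (d : {ffun 'I_4 -> rat}) :
    \sum_i d i *: tnth [tuple 1; theta; e2; e1] i
  = d (inord 3) *: e1 + d (inord 2) *: e2 + d (inord 1) *: e3
    + (d (inord 0) - d (inord 1) * r%:~R) *: 1.
  rewrite !big_ord_recl big_ord0 !(tnth_nth 0) /= e3E.
  have -> : lift ord0 (lift ord0 (lift ord0 ord0)) = inord 3 :> 'I_4.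
    by apply: val_inj; rewrite /= inordK.
  have -> : lift ord0 (lift ord0 ord0) = inord 2 :> 'I_4.
    by apply: val_inj; rewrite /= inordK.
  have -> : lift ord0 ord0 = inord 1 :> 'I_4 by apply: val_inj; rewrite /= inordK.
  have -> : ord0 = inord 0 :> 'I_4 by apply: val_inj; rewrite /= inordK.
  rewrite scalerDr scalerBl.
  have -> : (d (inord 1) * r%:~R) *: 1 = d (inord 1) *: r%:~R :> K.
    by rewrite -scalerA; congr (_ *: _); apply: alg_int.
  by ring.
exists (finfun cs); split.
  split.
    case=> [[|[|[|[|i]]]]] // hi; rewrite ffunE /cs /=.
    - have -> : c4 + c3 * r%:~R = (k4 + k3 * r)%:~R / m%:~R.
        by rewrite c4E c3E intrD intrM mulrDl; congr (_ + _); rewrite mulrAC.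
      exact: Zloc_div.
    - by rewrite c3E; apply: Zloc_div.
    - by rewrite c2E; apply: Zloc_div.
    - by rewrite c1E; apply: Zloc_div.
  by rewrite sumE !ffunE /cs !inordK //= addrK.
move=> d [_ dE]; apply/ffunP => i; rewrite ffunE /cs.
have := @free4 (c1 - d (inord 3)) (c2 - d (inord 2)) (c3 - d (inord 1))
   (c4 - (d (inord 0) - d (inord 1) * r%:~R)).
case.
  move: dE; rewrite sumE xE => /eqP; rewrite -subr_eq0 => /eqP <-.
  by rewrite !scalerBl; ring.
move=> /subr0_eq d1 /subr0_eq d2 /subr0_eq d3 /subr0_eq d4.
case: i => [[|[|[|[|i]]]]] // hi /=.
- rewrite d4 d3 subrK; congr (d _); apply: val_inj; by rewrite /= inordK.
- rewrite d3; congr (d _); apply: val_inj; by rewrite /= inordK.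
- rewrite d2; congr (d _); apply: val_inj; by rewrite /= inordK.
- rewrite d1; congr (d _); apply: val_inj; by rewrite /= inordK.
Qed.

End Order.

(** * The order attached to a Taylor expansion *)

Section PowerBasis.
Variables (K : fieldExtType rat) (theta : K) (a b c : int).
Let f := quartic a b c.
Hypothesis f_irr : irreducible_poly f.
Hypothesis f_root : root (map_poly intr f) theta.

Let fQ : {poly rat} := map_poly intr f.
Let fQ_irr : irreducible_poly fQ. Proof. exact/irreducible_rat_int. Qed.
Let size_fQ : size fQ = 5%N. Proof. by rewrite size_rat_int_poly size_quartic. Qed.

Let fQ_root : root (map_poly (in_alg K) fQ) theta.
Proof.
have -> // : map_poly (in_alg K) fQ = map_poly intr f.
by rewrite -map_poly_comp; apply: eq_map_poly => z; apply: alg_int.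
Qed.

Lemma quartic_root_eq :
  theta ^+ 4 + a%:~R * theta ^+ 2 + b%:~R * theta + c%:~R = 0.
Proof.
have := rootP f_root; rewrite /f quarticE map_Poly // horner_Poly /= => <-.
by ring.
Qed.

Let horner_size4 (g : {poly rat}) : (size g <= 4)%N ->
  (map_poly (in_alg K) g).[theta]
  = g`_0 *: 1 + g`_1 *: theta + g`_2 *: theta ^+ 2 + g`_3 *: theta ^+ 3.
Proof.
move=> sg; rewrite (@horner_coef_wide _ 4) ?size_map_poly //.
rewrite !big_ord_recl big_ord0 !coef_map /= !mulr_algl expr0 expr1 addr0 !addrA.
by [].
Qed.

(** A polynomial of degree at most 3 vanishing at [theta] would have a common
    factor with the irreducible f, which has degree 4. *)
Lemma power_basis_free (c0 c1 c2 c3 : rat) :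
  c0 *: 1 + c1 *: theta + c2 *: theta ^+ 2 + c3 *: theta ^+ 3 = 0 ->
  [/\ c0 = 0, c1 = 0, c2 = 0 & c3 = 0].
Proof.
pose g : {poly rat} := Poly [:: c0; c1; c2; c3].
have sg : (size g <= 4)%N by apply: (leq_trans (size_Poly _)).
have -> : c0 *: 1 + c1 *: theta + c2 *: theta ^+ 2 + c3 *: theta ^+ 3
  = (map_poly (in_alg K) g).[theta] by rewrite horner_size4 // !coef_Poly.
move=> g0.
suff gE : g = 0.
  have Hc i : [:: c0; c1; c2; c3]`_i = 0 by rewrite -coef_Poly -/g gE coef0.
  by split; [have := Hc 0%N | have := Hc 1%N | have := Hc 2%N | have := Hc 3%N].
apply/eqP; apply: contraT => gn0.
have rd : root (map_poly (in_alg K) (gcdp g fQ)) theta.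
  by rewrite gcdp_map root_gcd fQ_root andbT; apply/rootP.
have sd : size (gcdp g fQ) != 1%N.
  apply/eqP => /eqP /size_poly1P [d d0 dE].
  by move: rd; rewrite dE map_polyC rootC fmorph_eq0 (negPf d0).
have dd : gcdp g fQ %= fQ by apply: fQ_irr.2 => //; apply: dvdp_gcdr.
have : fQ %| g by rewrite -(eqp_dvdl _ dd) dvdp_gcdl.
move/dvdp_leq => /(_ gn0); rewrite size_fQ => /leq_trans /(_ sg).
by rewrite ltnn.
Qed.

Lemma power_basis_span (x : K) : <<1%VS; theta>>%VS = fullv ->
  exists c0 c1 c2 c3 : rat,
    x = c0 *: 1 + c1 *: theta + c2 *: theta ^+ 2 + c3 *: theta ^+ 3.
Proof.
move=> full; have : x \in <<1%VS; theta>>%VS by rewrite full memvf.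
case/Fadjoin1_polyP => g ->; have fQ0 : fQ != 0 by rewrite -size_poly_gt0 size_fQ.
exists (g %% fQ)`_0, (g %% fQ)`_1, (g %% fQ)`_2, (g %% fQ)`_3.
rewrite -horner_size4; last by rewrite -ltnS -size_fQ ltn_modp.
rewrite {1}(divp_eq g fQ) rmorphD rmorphM /= !hornerE (rootP fQ_root).
by rewrite mulr0 add0r.
Qed.
End PowerBasis.

Section TaylorOrder.
Variables (p : nat) (K : fieldExtType rat) (theta : K) (a b c s : int).
Let f := quartic a b c.
Hypothesis pp : prime p.
Hypothesis p_gt3 : (3 < p)%N.
Hypothesis f_irr : irreducible_poly f.
Hypothesis f_root : root (map_poly intr f) theta.
Hypothesis f_full : <<1%VS; theta>>%VS = fullv.
Hypothesis ps : ~~ (p%:Z %| s)%Z.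
Variables (P h b2 a1 k0 : int).
Hypothesis P0 : P != 0.
Hypothesis h0 : h != 0.
Hypothesis A2E : 6 * s ^+ 2 + a = P * b2.
Hypothesis A1E : 4 * s ^+ 3 + 2 * a * s + b = P ^+ 2 * h * a1.
Hypothesis A0E : s ^+ 4 + a * s ^+ 2 + b * s + c = P ^+ 3 * h ^+ 2 * k0.

Let q1 : K := theta ^+ 3 + s%:~R * theta ^+ 2 + (s ^+ 2 + a)%:~R * theta
                + (s ^+ 3 + a * s + b)%:~R.
Let q2 : K := theta ^+ 2 + 2 * s%:~R * theta + (3 * s ^+ 2 + a)%:~R.
Let e1 := q1 / (P ^+ 2 * h)%:~R.
Let e2 := q2 / P%:~R.
Let e3 := theta + (3 * s)%:~R.

Let PK0 : P%:~R != 0 :> K. Proof. by rewrite intrK_eq0. Qed.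
Let hK0 : h%:~R != 0 :> K. Proof. by rewrite intrK_eq0. Qed.
Let D0 : (P ^+ 2 * h)%:~R != 0 :> K. Proof. by rewrite intrK_eq0 !mulf_neq0. Qed.

Let rel := quartic_root_eq f_root.

Let A2 : K := (6 * s ^+ 2 + a)%:~R.
Let A1 : K := (4 * s ^+ 3 + 2 * a * s + b)%:~R.
Let A0 : K := (s ^+ 4 + a * s ^+ 2 + b * s + c)%:~R.

(* The products of the quotients q1, q2, e3 follow from the Horner relations
   t q1 = - A0, t q2 = q1 - A1, t e3 = q2 - A2 alone. *)
Let t : K := theta - s%:~R.
Let tq1 : t * q1 = - A0.
Proof. by apply/eqP; rewrite -subr_eq0 -rel; apply/eqP; rewrite /t /q1 /A0; ring. Qed.
Let tq2 : t * q2 = q1 - A1. Proof. rewrite /t /q1 /q2 /A1; ring. Qed.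
Let te3 : t * e3 = q2 - A2. Proof. rewrite /t /e3 /q2 /A2; ring. Qed.
Let e3t : e3 = t + (4 * s)%:~R. Proof. rewrite /t /e3; ring. Qed.

Let Q11 : q1 * q1 = A1 * q1 - A0 * q2.
Proof.
have -> : q1 * q1 = (t * q1) * q2 + A1 * q1 by rewrite (mulrC t) -mulrA tq2; ring.
by rewrite tq1; ring.
Qed.
Let Q12 : q1 * q2 = A2 * q1 - A0 * e3.
Proof.
have -> : q1 * q2 = (t * q1) * e3 + A2 * q1 by rewrite (mulrC t) -mulrA te3; ring.
by rewrite tq1; ring.
Qed.
Let Q13 : q1 * e3 = (4 * s)%:~R * q1 - A0.
Proof. by rewrite e3t mulrDr [q1 * t]mulrC tq1; ring. Qed.
Let Q23 : q2 * e3 = q1 + (4 * s)%:~R * q2 - A1.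
Proof. by rewrite e3t mulrDr [q2 * t]mulrC tq2; ring. Qed.
Let Q33 : e3 * e3 = q2 + (4 * s)%:~R * e3 - A2.
Proof. by rewrite {2}e3t mulrDr [e3 * t]mulrC te3; ring. Qed.
Let Q22 : q2 * q2 = (4 * s)%:~R * q1 + A2 * q2 - A1 * e3 - A0.
Proof.
have -> : q2 * q2 = (t * q2) * e3 + A2 * q2 by rewrite (mulrC t) -mulrA te3; ring.
by rewrite tq2 mulrBl Q13; ring.
Qed.

Let A2P : A2 = P%:~R * b2%:~R. Proof. by rewrite /A2 A2E intrM. Qed.
Let A1P : A1 = P%:~R ^+ 2 * h%:~R * a1%:~R. Proof. by rewrite /A1 A1E; ring. Qed.
Let A0P : A0 = P%:~R ^+ 3 * h%:~R ^+ 2 * k0%:~R. Proof. by rewrite /A0 A0E; ring. Qed.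
Let DE : (P ^+ 2 * h)%:~R = P%:~R ^+ 2 * h%:~R :> K. Proof. by ring. Qed.

Let M11 : e1 * e1 = a1%:~R * e1 - k0%:~R * e2.
Proof. by rewrite /e1 /e2 mulf_div Q11 A1P A0P DE; field; rewrite PK0 hK0. Qed.
Let M12 : e1 * e2 = b2%:~R * e1 - (h * k0)%:~R * e3.
Proof. by rewrite /e1 /e2 mulf_div Q12 A2P A0P DE; field; rewrite PK0 hK0. Qed.
Let M22 : e2 * e2 = (4 * s * h)%:~R * e1 + b2%:~R * e2 - (h * a1)%:~R * e3
                    - (P * h ^+ 2 * k0)%:~R.
Proof. by rewrite /e1 /e2 mulf_div Q22 A2P A1P A0P DE; field; rewrite PK0 hK0. Qed.
Let M13 : e1 * e3 = (4 * s)%:~R * e1 - (P * h * k0)%:~R.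
Proof. by rewrite /e1 mulrAC Q13 A0P DE; field; rewrite PK0 hK0. Qed.
Let M23 : e2 * e3 = (P * h)%:~R * e1 + (4 * s)%:~R * e2 - (P * h * a1)%:~R.
Proof. by rewrite /e1 /e2 mulrAC Q23 A1P DE; field; rewrite PK0 hK0. Qed.
Let M33 : e3 * e3 = P%:~R * e2 + (4 * s)%:~R * e3 - (P * b2)%:~R.
Proof. by rewrite /e2 Q33 A2P; field; rewrite PK0. Qed.

(* The change of basis to the powers of theta is triangular. *)
Let coordsE (c1 c2 c3 c4 : rat) :
  c1 *: e1 + c2 *: e2 + c3 *: e3 + c4 *: 1
  = (c1 / (P ^+ 2 * h)%:~R * (s ^+ 3 + a * s + b)%:~R + c2 / P%:~R * (3 * s ^+ 2 + a)%:~R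
       + c3 * (3 * s)%:~R + c4) *: 1
    + (c1 / (P ^+ 2 * h)%:~R * (s ^+ 2 + a)%:~R + c2 / P%:~R * (2 * s)%:~R + c3) *: theta
    + (c1 / (P ^+ 2 * h)%:~R * s%:~R + c2 / P%:~R) *: theta ^+ 2
    + (c1 / (P ^+ 2 * h)%:~R) *: theta ^+ 3.
Proof.
have [g gE] : exists g : {rmorphism rat -> K}, forall c (x : K), c *: x = g c * x.
  by exists (in_alg K) => c' x; rewrite mulr_algl.
rewrite !gE !(rmorphD g, rmorphM g, fmorphV g, rmorph_int g).
rewrite /e1 /e2 /e3 /q1 /q2; ring.
Qed.

Let free4 (c1 c2 c3 c4 : rat) :
  c1 *: e1 + c2 *: e2 + c3 *: e3 + c4 *: 1 = 0 -> [/\ c1 = 0, c2 = 0, c3 = 0 & c4 = 0].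
Proof.
rewrite coordsE => /(power_basis_free f_irr f_root) [z0 z1 z2 z3].
have d0 : (P ^+ 2 * h)%:~R != 0 :> rat by rewrite intr_eq0 !mulf_neq0.
have p0 : P%:~R != 0 :> rat by rewrite intr_eq0.
have c10 : c1 = 0 by move/eqP: z3; rewrite mulf_eq0 invr_eq0 (negPf d0) orbF => /eqP.
have c20 : c2 = 0.
  by move/eqP: z2; rewrite c10 !mul0r add0r mulf_eq0 invr_eq0 (negPf p0) orbF => /eqP.
have c30 : c3 = 0 by move: z1; rewrite c10 c20 !mul0r !add0r.
by split=> //; move: z0; rewrite c10 c20 c30 !mul0r !add0r.
Qed.

Let span4 (x : K) : exists c1 c2 c3 c4 : rat,
  x = c1 *: e1 + c2 *: e2 + c3 *: e3 + c4 *: 1.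
Proof.
have [d0 [d1 [d2 [d3 ->]]]] := power_basis_span f_root x f_full.
have n1 : (P ^+ 2 * h)%:~R != 0 :> rat by rewrite intr_eq0 !mulf_neq0.
have n2 : P%:~R != 0 :> rat by rewrite intr_eq0.
pose c1 := d3 * (P ^+ 2 * h)%:~R; pose c2 := (d2 - d3 * s%:~R) * P%:~R.
pose c3 := d1 - d3 * (s ^+ 2 + a)%:~R - (d2 - d3 * s%:~R) * (2 * s)%:~R.
exists c1, c2, c3, (d0 - d3 * (s ^+ 3 + a * s + b)%:~R
  - (d2 - d3 * s%:~R) * (3 * s ^+ 2 + a)%:~R - c3 * (3 * s)%:~R).
rewrite coordsE /c1 /c2 !mulfK //.
by congr (_ *: _ + _ *: _ + _ *: _ + _ *: _); rewrite /c3; ring.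
Qed.

Lemma taylor_order_basis :
  (p%:Z %| P * h * k0)%Z -> (p%:Z %| P * h * a1)%Z -> (p%:Z %| P * b2)%Z ->
  [\/ ~~ (p%:Z %| cubic_disc (4 * s * h) b2 a1 k0)%Z,
      [/\ (p%:Z %| a1)%Z, (p%:Z %| k0)%Z, ~~ (p%:Z ^+ 2 %| k0)%Z
         & ~~ (p%:Z %| b2)%Z || ~~ (p%:Z %| h)%Z]
    | [/\ (p%:Z %| b2)%Z, (p%:Z %| h)%Z, ~~ (p%:Z ^+ 2 %| h)%Z
         & ~~ (p%:Z %| a1)%Z || ~~ (p%:Z %| k0)%Z]] ->
  pintegral_basis p [tuple 1; theta; e2; e1].
Proof.
move=> pPhk pPha pPb crit.
have pA3 : ~~ (p%:Z %| 4 * s)%Z.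
  by apply: ndvdzM => //; rewrite dvdzE (Euclid_dvdM 2 2) // orbb gtnNdvd // ltnW.
apply: (pintegral_basis_of_saturated pp M11 M12 M22 M13 M23 M33 free4 _ (erefl e3)) => //.
case: crit => [pD | [pa pk p2k form] | [pb ph p2h form]].
- exact: (saturated_unramified pp M11 M12 M22 M13 M23 M33).
- exact: (saturated_ramified1 pp M11 M12 M22 M13 M23 M33).
- exact: (saturated_ramified2 pp M11 M12 M22 M13 M23 M33).
Qed.
End TaylorOrder.

(** * Sides of the Newton polygon *)

Section DoubleRoot.
Variable F : fieldType.

Lemma separable_of_bezout (R u v : {poly F}) (d : F) :
  d != 0 -> u * R + v * R^`() = d%:P -> separable_poly R.
Proof.
move=> d0 E; rewrite separable_poly.unlock; apply/Bezout_coprimepP; exists (u, v) => /=.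
by rewrite E polyC_eqp1.
Qed.

Lemma double_rootP (R : {poly F}) (y : F) : R != 0 ->
  (1 < mup y R)%N = (R.[y] == 0) && (R^`().[y] == 0).
Proof.
move=> R0; rewrite -[(1 < _)%N]/(2 <= mup y R)%N mup_geq //; apply/idP/andP.
  case/dvdpP => q ->; rewrite expr2 !derivM derivXsubC.
  by rewrite !(hornerXsubC, hornerD, hornerM, hornerC); split; apply/eqP; ring.
move=> [/factor_theorem [q E]]; rewrite E derivM derivXsubC hornerD !hornerM.
rewrite hornerXsubC hornerC subrr mulr0 add0r mulr1 => /factor_theorem [q' ->].
by rewrite expr2 -mulrA dvdp_mulIr.
Qed.

Lemma double_root_not_separable (R : {poly F}) (y : F) :
  R.[y] = 0 -> R^`().[y] = 0 -> ~~ separable_poly R.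
Proof.
rewrite separable_poly.unlock => r0 r1; apply/negP => /coprimep_root.
have ry : root R y by apply/eqP.
by move/(_ y ry); rewrite r1 eqxx.
Qed.
End DoubleRoot.

Section Sides.
Variables (p : nat) (f : {poly int}) (s : int).
Hypothesis pp : prime p.
Local Notation A := (taylor f s).
Local Notation w k := (ordp p (A k)).
Local Notation side := (is_side p f s).
Local Notation slope := (slope p f s).
Local Notation line := (line p f s).

Lemma line_affine (i j k l : nat) :
  line i j k = line i j l + slope i j * (k%:R - l%:R).
Proof. by rewrite /Defs.line; ring. Qed.

Lemma line_left (i j : nat) : line i j i = ordinate p f s i.
Proof. by rewrite /Defs.line subrr mulr0 addr0. Qed.

Lemma line_right (i j : nat) : (i < j)%N -> line i j j = ordinate p f s j.
Proof.
move=> lij; rewrite /Defs.line /Defs.slope divfK; first by rewrite addrC subrK.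
by rewrite subr_eq0 eqr_nat gtn_eqF.
Qed.

(** The line through a side is an affine function lying below the polygon, and two
    affine functions compare on an interval as they do at its ends. *)
Lemma side_convex (i j i' j' : 'I_5) (k : nat) :
  side i j -> side i' j' -> (i <= k <= j)%N -> line i' j' k <= line i j k.
Proof.
move=> /and5P [lij Ai Aj _ _] /and5P [_ _ _ _ /forallP ab'] /andP [lik lkj].
have := ab' i; rewrite Ai /= => /andP [li' _].
have := ab' j; rewrite Aj /= => /andP [lj' _].
rewrite -(line_left i j) in li'; rewrite -(line_right lij) in lj'.
have ik : (0 : rat) <= k%:R - i%:R by rewrite subr_ge0 ler_nat.
have kj : (0 : rat) <= j%:R - k%:R by rewrite subr_ge0 ler_nat.
have ij : (0 : rat) < j%:R - i%:R by rewrite subr_gt0 ltr_nat.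
rewrite -(ler_pM2r ij).
have E (i0 j0 : nat) : line i0 j0 k * (j%:R - i%:R)
   = line i0 j0 i * (j%:R - k%:R) + line i0 j0 j * (k%:R - i%:R).
  by rewrite (line_affine i0 j0 i k) (line_affine i0 j0 j k); ring.
by rewrite !E lerD // ler_wpM2r.
Qed.

(** By convexity a point above the range of a side is on the polygon only if it is
    on that side, so the other sides do not interfere. *)
Lemma polygon_coef_side (i j : 'I_5) (k : 'I_5) : side i j -> (i <= k <= j)%N ->
  polygon_coef p f s k =
    if (A k != 0) && (ordinate p f s k == line i j k)
    then (unit_part p (A k))%:~R else 0.
Proof.
move=> sij ikj; rewrite /polygon_coef /on_polygon; congr (if _ then _ else _).
have [Ak|//] := boolP (A k != 0); rewrite /=.
apply/existsP/idP => [[i' /existsP [j' /and3P [sij' ikj' /eqP ek]]]|ek].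
  rewrite eq_le; apply/andP; split; first by rewrite ek side_convex.
  by case/and5P: sij => _ _ _ _ /forallP /(_ k); rewrite Ak /= => /andP [].
by exists i; apply/existsP; exists j; rewrite sij ikj ek.
Qed.

(** Clearing denominators: for a side of slope -mu, all comparisons become
    comparisons of the natural numbers w_k + mu k. *)
Lemma side_slope_int (i j : 'I_5) (mu : nat) :
  (side i j && (slope i j == - mu%:R)) =
  [&& (i < j)%N, A i != 0, A j != 0, (0 < mu)%N, w i + mu * i == w j + mu * j &
    [forall k : 'I_5, (A k != 0) ==> (w i + mu * i <= w k + mu * k) &&
       ((w i + mu * i == w k + mu * k) ==> (i <= k <= j))]]%N.
Proof.
rewrite /is_side; have [lij|] //= := ltnP i j.
have [Ai|] //= := boolP (A i != 0); have [Aj|] //= := boolP (A j != 0).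
have ij : (j%:R - i%:R : rat) != 0 by rewrite subr_eq0 eqr_nat gtn_eqF.
have sE : (slope i j == - mu%:R) = (w i + mu * i == w j + mu * j)%N.
  rewrite /Defs.slope -(inj_eq (mulIf ij)) divfK // -(eqr_nat rat) !natrD !natrM.
  rewrite -[RHS]subr_eq0 -[LHS]subr_eq0 -[in RHS]oppr_eq0 /ordinate.
  by congr (_ == 0); ring.
rewrite -sE; have [slE|] := eqVneq (slope i j) (- mu%:R); last by rewrite !andbF.
rewrite andbT {1}slE oppr_lt0 ltr0n; congr (_ && _); apply: eq_forallb => k.
have lE : line i j k = (w i + mu * i)%:R - (mu * k)%:R.
  by rewrite /Defs.line slE /ordinate natrD !natrM; ring.
rewrite lE lerBlDr /ordinate -natrD ler_nat; congr (_ ==> _ && (_ ==> _)).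
by rewrite eq_sym subr_eq -natrD eqr_nat.
Qed.

Let pX0 k : p%:Z ^+ k != 0.
Proof. by rewrite expf_neq0 // eqz_nat -lt0n prime_gt0. Qed.

Let castF (z : int) : (p%:Z %| z)%Z = (z%:~R == 0 :> 'F_p).
Proof. exact: dvdz_pcharf (pchar_Fp pp) z. Qed.

(** Over a side of slope -mu, the substitution x = s + p^mu Y makes f divisible by
    p^(w_i + mu i), and the coefficients B_k of the quotient reduce mod p to the
    coefficients of the polygon on the side and to 0 elsewhere. *)
Lemma side_int_coefs (i j : 'I_5) (mu : nat) :
  side i j -> slope i j = - mu%:R ->
  exists B : nat -> int,
  [/\ forall k : 'I_5, A k * p%:Z ^+ (mu * k) = p%:Z ^+ (w i + mu * i) * B k,
      forall k : 'I_5, (i <= k <= j)%N -> polygon_coef p f s k = (B k)%:~R,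
      forall k : 'I_5, ~~ (i <= k <= j)%N -> (p%:Z %| B k)%Z &
      ~~ (p%:Z %| B i)%Z /\ ~~ (p%:Z %| B j)%Z].
Proof.
move=> sij slE; have := side_slope_int i j mu; rewrite sij slE eqxx /=.
case/esym/and5P => lij Ai Aj mu0 /andP [/eqP wij /forallP above].
set c := (w i + mu * i)%N in wij above *.
pose B k := ((A k * p%:Z ^+ (mu * k)) %/ p%:Z ^+ c)%Z.
have BE (k : 'I_5) : A k * p%:Z ^+ (mu * k) = p%:Z ^+ c * B k.
  rewrite [RHS]mulrC divzK //; have [->|Ak] := eqVneq (A k) 0.
    by rewrite mul0r dvdz0.
  have := above k; rewrite Ak /= => /andP [le _].
  rewrite -{1}(unit_partE pp (A k)) -mulrA -exprD dvdz_mull //.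
  by rewrite -(subnK le) exprD dvdz_mull.
have Bon (k : 'I_5) : A k != 0 -> (c = w k + mu * k)%N -> B k = unit_part p (A k).
  move=> Ak ck; apply: (mulfI (pX0 c)); rewrite -BE -{1}(unit_partE pp (A k)).
  by rewrite -mulrA -exprD -ck mulrC.
have Boff (k : 'I_5) : (A k = 0) \/ (c < w k + mu * k)%N -> (p%:Z %| B k)%Z.
  case=> [Ak|lt].
    have : p%:Z ^+ c * B k = 0 by rewrite -BE Ak mul0r.
    by move/eqP; rewrite mulf_eq0 (negPf (pX0 _)) => /eqP ->; rewrite dvdz0.
  rewrite -(@dvdz_mul2l _ _ _ (pX0 c)) -BE -exprSr -(unit_partE pp (A k)).
  by rewrite -mulrA -exprD dvdz_mull // -(subnK lt) exprD dvdz_mull.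
exists B; split=> // [k ikj|k ikj|].
- rewrite (polygon_coef_side sij ikj); have [Ak|Ak] /= := eqVneq (A k) 0.
    by apply/esym/eqP; rewrite -castF; apply: Boff; left.
  have -> : (ordinate p f s k == line i j k) = (c == w k + mu * k)%N.
    rewrite /Defs.line slE /ordinate -(eqr_nat rat) !natrD !natrM.
    rewrite -[LHS]subr_eq0 -[RHS]subr_eq0 -[RHS]oppr_eq0.
    by congr (_ == 0); ring.
  have [ck|ck] := eqVneq c (w k + mu * k)%N; first by rewrite Bon.
  apply/esym/eqP; rewrite -castF; apply: Boff; right.
  by have := above k; rewrite Ak /= => /andP [le _]; rewrite ltn_neqAle ck.
- apply: Boff; have [|Ak] := eqVneq (A k) 0; [by left | right].
  have := above k; rewrite Ak /= => /andP [le eqk]; rewrite ltn_neqAle le andbT.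
  by apply: contra ikj => /(implyP eqk).
- by rewrite !Bon // !unit_part_ndvd.
Qed.

Lemma side_int_residual (i j : 'I_5) (mu : nat) : slope i j = - mu%:R ->
  residual_poly p f s i j = \poly_(k < (j - i).+1) polygon_coef p f s (i + k).
Proof.
move=> slE; rewrite /residual_poly /side_d /side_e slE.
have -> : denq (- mu%:R) = 1 by rewrite denqN (denq_int mu).
rewrite divn1; apply/polyP => k; rewrite !coef_poly muln1 //.
Qed.

Lemma side_residual_int (i j : 'I_5) (mu : nat) :
  side i j -> slope i j = - mu%:R ->
  exists B : nat -> int,
  [/\ forall k, (k < 5)%N -> A k * p%:Z ^+ (mu * k) = p%:Z ^+ (w i + mu * i) * B k,
      residual_poly p f s i j = \poly_(m < (j - i).+1) (B (i + m)%N)%:~R,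
      forall k, (k < 5)%N -> ~~ (i <= k <= j)%N -> (p%:Z %| B k)%Z &
      ~~ (p%:Z %| B i)%Z /\ ~~ (p%:Z %| B j)%Z].
Proof.
move=> sij slE; have [B [BE Bon Boff Bij]] := side_int_coefs sij slE.
exists B; split=> // [k hk||k hk].
- exact: (BE (Ordinal hk)).
- rewrite (side_int_residual slE); apply/polyP => m; rewrite !coef_poly.
  case: ltnP => // hm; have lij : (i < j)%N by case/and5P: sij.
  have hk : (i + m < 5)%N.
    by apply: leq_ltn_trans (ltn_ord j); lia.
  by apply: (Bon (Ordinal hk)) => /=; lia.
- exact: (Boff (Ordinal hk)).
Qed.

Hypothesis A3 : ~~ (p%:Z %| A 3)%Z.
Hypothesis A4 : ~~ (p%:Z %| A 4)%Z.

(** The points (3, 0) and (4, 0) are on the polygon, so it does not decrease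
    after abscissa 3. *)
Lemma side_le3 (i j : 'I_5) : side i j -> (j <= 3)%N.
Proof.
case: j => [[|[|[|[|[|j]]]]]] // hj /and5P [li _ _ sl0 /forallP above].
have w0 (k : nat) : ~~ (p%:Z %| A k)%Z -> w k = 0%N.
  by move=> Ak; rewrite -(mulr1 (A k)) -(expr0 p%:Z) ordp_eq.
have A30 : A 3 != 0 by apply: contra A3 => /eqP ->; rewrite dvdz0.
have /andP [] := implyP (above (Ordinal (isT : 3 < 5)%N)) A30.
have -> : line i (Ordinal hj) (Ordinal (isT : 3 < 5)%N)
  = ordinate p f s 4 - slope i (Ordinal hj).
  rewrite (line_affine _ _ _ (Ordinal hj)) line_right //=; ring.
by rewrite /ordinate !w0 // sub0r oppr_le0 leNgt sl0.
Qed.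

Lemma side_e_dvd (i j : 'I_5) : side i j -> (side_e p f s i j %| j - i)%N.
Proof.
case/andP => lij _; rewrite /side_e; set q := slope i j.
have E : numq q * (j - i)%N%:Z = ((w j)%:Z - (w i)%:Z) * denq q.
  apply/eqP; rewrite -(eqr_int rat) !intrM intrB -!pmulrn.
  have <- : q * (j - i)%N%:R = (w j)%:R - (w i)%:R.
    rewrite natrB ?(ltnW lij) // /q /Defs.slope divfK //.
    by rewrite subr_eq0 eqr_nat gtn_eqF.
  by rewrite [X in _ == X]mulrAC -{2}(divq_num_den q) divfK ?intr_eq0 ?denq_neq0.
have : (denq q %| numq q * (j - i)%N%:Z)%Z by rewrite E dvdz_mull.
rewrite Gauss_dvdzr; first by rewrite dvdzE.
by rewrite coprimezE coprime_sym coprime_num_den.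
Qed.

Lemma residual_deg1_separable (i j : 'I_5) :
  side i j -> side_d p f s i j = 1%N -> separable_poly (residual_poly p f s i j).
Proof.
move=> sij d1; rewrite /residual_poly d1.
set R := \poly_(k < 2) _.
have ej : (i + side_e p f s i j = j)%N.
  have := side_e_dvd sij; move: d1; rewrite /side_d => d1 /divnK.
  by rewrite d1 mul1n => ->; rewrite subnKC //; case/and5P: sij => /ltnW.
have cj : polygon_coef p f s j != 0.
  have ijj : (i <= j <= j)%N by case/and5P: sij => /ltnW -> *; rewrite leqnn.
  rewrite (polygon_coef_side sij ijj); case/and5P: sij => lij _ Aj _ _.
  by rewrite Aj (line_right lij) eqxx /= -castF unit_part_ndvd.
apply: (@separable_of_bezout _ _ 0 1 _ cj).
rewrite mul0r add0r mul1r; apply/polyP => k; rewrite coef_deriv coef_poly coefC.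
by case: k => [|k] /=; rewrite ?mul0rn // mul1n ej.
Qed.

(** A residual polynomial of degree 1 is separable. As sides have horizontal
    length at most 3, which is d e, a degree d of at least 2 forces e = 1. *)
Lemma inseparable_side (i j : 'I_5) :
  side i j -> ~~ separable_poly (residual_poly p f s i j) ->
  exists2 mu : nat, slope i j = - mu%:R &
   [\/ i = 0%N :> nat /\ j = 2%N :> nat, i = 1%N :> nat /\ j = 3%N :> nat |
       i = 0%N :> nat /\ j = 3%N :> nat].
Proof.
move=> sij insep; have le3 := side_le3 sij.
have ed := side_e_dvd sij; have d1 : side_d p f s i j != 1%N.
  by apply: contra insep => /eqP; apply: residual_deg1_separable.
have lij : (i < j)%N by case/and5P: sij.
have e1 : side_e p f s i j = 1%N /\ (1 < j - i)%N.
  move: ed d1; rewrite /side_d; have : (0 < j - i <= 3)%N by lia.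
  move: (side_e _ _ _ _ _) (j - i)%N => e n.
  by case: n => [|[|[|[|n]]]] // _; case: e => [|[|[|[|e]]]].
have [e1' le2] := e1.
exists `|numq (slope i j)|%N; last first.
  have [H|[H|H]] : i = 0%N :> nat /\ j = 2%N :> nat \/
    i = 1%N :> nat /\ j = 3%N :> nat \/ i = 0%N :> nat /\ j = 3%N :> nat by lia.
  - by constructor 1.
  - by constructor 2.
  - by constructor 3.
have dE : denq (slope i j) = 1.
  by rewrite -[LHS](gtz0_abs (denq_gt0 _)); congr Posz.
have : slope i j < 0 by case/and5P: sij.
rewrite -numq_lt0 => n0; rewrite -[LHS]divq_num_den dE divr1.
transitivity ((- `|numq (slope i j)|%N%:Z)%:~R : rat); last by rewrite intrN.
by congr (_%:~R); rewrite ltz0_abs // opprK.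
Qed.

End Sides.

(** * Taylor coefficients, discriminants and residual polynomials of low degree *)

(** The discriminant of x^4 + A3 x^3 + A2 x^2 + A1 x + A0. *)
Definition quartic_disc (A3 A2 A1 A0 : int) : int :=
  256 * A0 ^+ 3 - 192 * A3 * A1 * A0 ^+ 2 - 128 * A2 ^+ 2 * A0 ^+ 2
  + 144 * A2 * A1 ^+ 2 * A0 - 27 * A1 ^+ 4 + 144 * A3 ^+ 2 * A2 * A0 ^+ 2
  - 6 * A3 ^+ 2 * A1 ^+ 2 * A0 - 80 * A3 * A2 ^+ 2 * A1 * A0
  + 18 * A3 * A2 * A1 ^+ 3 + 16 * A2 ^+ 4 * A0 - 4 * A2 ^+ 3 * A1 ^+ 2
  - 27 * A3 ^+ 4 * A0 ^+ 2 + 18 * A3 ^+ 3 * A2 * A1 * A0 - 4 * A3 ^+ 3 * A1 ^+ 3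
  - 4 * A3 ^+ 2 * A2 ^+ 3 * A0 + A3 ^+ 2 * A2 ^+ 2 * A1 ^+ 2.

(** What the discriminant of the quartic adds to that of its cubic part, see
    [quartic_disc_scaled]; each term is divisible by a1 or k0. *)
Definition disc_rest (A3 P h b2 a1 k0 : int) : int :=
  256 * P ^+ 2 * h ^+ 4 * k0 ^+ 3 - 192 * A3 * P * h ^+ 3 * a1 * k0 ^+ 2
  - 128 * P * h ^+ 2 * b2 ^+ 2 * k0 ^+ 2 + 144 * P * h ^+ 2 * b2 * a1 ^+ 2 * k0
  - 27 * P * h ^+ 2 * a1 ^+ 4 + 144 * A3 ^+ 2 * h ^+ 2 * b2 * k0 ^+ 2
  - 6 * A3 ^+ 2 * h * a1 ^+ 2 * (h * k0) - 80 * A3 * h * b2 ^+ 2 * a1 * k0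
  + 18 * A3 * h * b2 * a1 ^+ 3 + 16 * b2 ^+ 4 * k0 - 4 * b2 ^+ 3 * a1 ^+ 2.

(** The discriminant is weighted homogeneous, and A4 = 1 lowers the weight of no
    term below that of the discriminant of A3 x^3 + A2 x^2 + A1 x + A0: a common
    power of p comes out, and what is left is governed by the reduced cubic form. *)
Lemma quartic_disc_scaled (A3 P h b2 a1 k0 : int) :
  quartic_disc A3 (P * b2) (P ^+ 2 * h * a1) (P ^+ 3 * h ^+ 2 * k0)
  = P ^+ 6 * h ^+ 2
    * (A3 ^+ 2 * cubic_disc (A3 * h) b2 a1 k0 + P * disc_rest A3 P h b2 a1 k0).
Proof. rewrite /quartic_disc /cubic_disc /disc_rest; ring. Qed.

Section Taylor.
Variables (a b c s : int).
Let f := quartic a b c.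

Lemma taylor0 : taylor f s 0 = s ^+ 4 + a * s ^+ 2 + b * s + c.
Proof.
rewrite /taylor nderivn0 /f quarticE horner_Poly /=; ring.
Qed.

Lemma taylor_coefs (i : nat) : taylor f s i =
  \sum_(k < 5) [:: c; b; a; 0; 1]`_(i + k) *+ 'C(i + k, i) * s ^+ k.
Proof.
rewrite /taylor (@horner_coef_wide _ 5).
  by apply: eq_bigr => k _; rewrite coef_nderivn /f quarticE coef_Poly.
by rewrite (leq_trans (size_poly _ _)) // size_quartic leq_subr.
Qed.

Lemma taylor1 : taylor f s 1 = 4 * s ^+ 3 + 2 * a * s + b.
Proof. by rewrite taylor_coefs !big_ord_recl big_ord0 /= /bump /= ?(binS, bin0, bin0n) /=; ring. Qed.

Lemma taylor2 : taylor f s 2 = 6 * s ^+ 2 + a.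
Proof. by rewrite taylor_coefs !big_ord_recl big_ord0 /= /bump /= ?(binS, bin0, bin0n) /=; ring. Qed.

Lemma taylor3 : taylor f s 3 = 4 * s.
Proof. by rewrite taylor_coefs !big_ord_recl big_ord0 /= /bump /= ?(binS, bin0, bin0n) /=; ring. Qed.

Lemma taylor4 : taylor f s 4 = 1.
Proof. by rewrite taylor_coefs !big_ord_recl big_ord0 /= /bump /= ?(binS, bin0, bin0n) /=; ring. Qed.

Lemma disc_taylor : disc f =
  quartic_disc (taylor f s 3) (taylor f s 2) (taylor f s 1) (taylor f s 0).
Proof.
by rewrite disc_quarticE taylor0 taylor1 taylor2 taylor3 /quartic_disc; ring.
Qed.
End Taylor.

Section Translate.
Variables (a b c s Y : int).
Let f := quartic a b c.
Lemma taylor0_translate : taylor f (s + Y) 0 =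
  taylor f s 0 + taylor f s 1 * Y + taylor f s 2 * Y ^+ 2 + taylor f s 3 * Y ^+ 3 + Y ^+ 4.
Proof. by rewrite !taylor0 taylor1 taylor2 taylor3; ring. Qed.

Lemma taylor1_translate : taylor f (s + Y) 1 =
  taylor f s 1 + 2 * taylor f s 2 * Y + 3 * taylor f s 3 * Y ^+ 2 + 4 * Y ^+ 3.
Proof. by rewrite !taylor1 taylor2 taylor3; ring. Qed.

Lemma taylor2_translate : taylor f (s + Y) 2 =
  taylor f s 2 + 3 * taylor f s 3 * Y + 6 * Y ^+ 2.
Proof. by rewrite !taylor2 taylor3; ring. Qed.
End Translate.

Section SmallResiduals.
Variable F : fieldType.

Lemma poly3E (c : nat -> F) :
  \poly_(m < 3) c m = (c 2)%:P * 'X^2 + (c 1)%:P * 'X + (c 0)%:P.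
Proof. by rewrite poly_def !big_ord_recl big_ord0 /= -!mul_polyC /bump /=; ring. Qed.

Lemma poly4E (c : nat -> F) :
  \poly_(m < 4) c m = (c 3)%:P * 'X^3 + (c 2)%:P * 'X^2 + (c 1)%:P * 'X + (c 0)%:P.
Proof. by rewrite poly_def !big_ord_recl big_ord0 /= -!mul_polyC /bump /=; ring. Qed.

Lemma deriv_poly3E (c : nat -> F) :
  (\poly_(m < 3) c m)^`() = (2 * c 2)%:P * 'X + (c 1)%:P.
Proof.
rewrite poly3E !derivD !derivM !derivC ?derivXn ?derivX /=.
by rewrite polyCM; ring.
Qed.

Lemma deriv_poly4E (c : nat -> F) :
  (\poly_(m < 4) c m)^`() = (3 * c 3)%:P * 'X^2 + (2 * c 2)%:P * 'X + (c 1)%:P.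
Proof.
rewrite poly4E !derivD !derivM !derivC ?derivXn ?derivX /=.
by rewrite !polyCM; ring.
Qed.

Lemma poly3_double_root (c : nat -> F) (y : F) :
  ((\poly_(m < 3) c m).[y] = c 2 * y ^+ 2 + c 1 * y + c 0) *
  ((\poly_(m < 3) c m)^`().[y] = 2 * c 2 * y + c 1).
Proof. by rewrite deriv_poly3E poly3E !(hornerD, hornerM, hornerC, hornerXn, hornerX). Qed.

Lemma poly4_double_root (c : nat -> F) (y : F) :
  ((\poly_(m < 4) c m).[y] = c 3 * y ^+ 3 + c 2 * y ^+ 2 + c 1 * y + c 0) *
  ((\poly_(m < 4) c m)^`().[y] = 3 * c 3 * y ^+ 2 + 2 * c 2 * y + c 1).
Proof. by rewrite deriv_poly4E poly4E !(hornerD, hornerM, hornerC, hornerXn, hornerX). Qed.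

(** Bezout relation between c2 y^2 + c1 y + c0 and its derivative. *)
Lemma quadratic_inseparable (c : nat -> F) :
  ~~ separable_poly (\poly_(m < 3) c m) -> c 1%N ^+ 2 = 4 * c 0%N * c 2%N.
Proof.
move=> insep; apply/eqP; apply: contraR insep; rewrite -subr_eq0 => d0.
apply: (@separable_of_bezout _ _ (- (4 * c 2%N)%:P) ((2 * c 2%N)%:P * 'X + (c 1%N)%:P) _ d0).
by rewrite deriv_poly3E poly3E !(polyCM, polyCB, polyCN, polyC_exp); ring.
Qed.

(** Bezout relation between c3 y^3 + c1 y + c0 and its derivative, through the
    combination 3 R - y R' = 2 c1 y + 3 c0. *)
Lemma cubic_inseparable (c : nat -> F) : c 2%N = 0 ->
  ~~ separable_poly (\poly_(m < 4) c m) ->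
  4 * c 1%N ^+ 3 + 27 * c 3%N * c 0%N ^+ 2 = 0.
Proof.
move=> c2 insep; apply/eqP; apply: contraR insep => d0.
pose u : {poly F} := - (9 * c 3%N)%:P * ((2 * c 1%N)%:P * 'X - (3 * c 0%N)%:P).
pose v : {poly F} := (4 * c 1%N ^+ 2)%:P
   + (3 * c 3%N)%:P * ((2 * c 1%N)%:P * 'X - (3 * c 0%N)%:P) * 'X.
apply: (@separable_of_bezout _ _ u v _ d0).
rewrite deriv_poly4E poly4E c2 /u /v !(polyCD, polyCM, polyCB, polyCN, polyC_exp); ring.
Qed.

Lemma quadratic_double_root (c : nat -> F) :
  (2 : F) != 0 -> c 2%N != 0 -> c 1%N ^+ 2 - 4 * c 0%N * c 2%N = 0 ->
  exists y, (\poly_(m < 3) c m).[y] = 0 /\ (\poly_(m < 3) c m)^`().[y] = 0.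
Proof.
move=> n2 n0 D0; exists (- c 1%N / (2 * c 2%N)); rewrite !poly3_double_root.
have n4 : (4 : F) != 0 by rewrite (_ : 4 = 2 * 2) ?mulf_neq0 //; ring.
split; last by field; rewrite ?n2 ?n4 ?n8 ?n0.
transitivity (- (4 * c 2%N)^-1 * (c 1%N ^+ 2 - 4 * c 0%N * c 2%N)); last first.
  by rewrite D0 mulr0.
by field; rewrite ?n2 ?n4 ?n8 ?n0.
Qed.

Lemma cubic_double_root (c : nat -> F) :
  (2 : F) != 0 -> c 1%N != 0 -> c 2%N = 0 ->
  4 * c 1%N ^+ 3 + 27 * c 3%N * c 0%N ^+ 2 = 0 ->
  exists y, (\poly_(m < 4) c m).[y] = 0 /\ (\poly_(m < 4) c m)^`().[y] = 0.
Proof.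
move=> n2 n1 c2 D0; exists (- 3 * c 0%N / (2 * c 1%N)).
rewrite !poly4_double_root c2.
have n4 : (4 : F) != 0 by rewrite (_ : 4 = 2 * 2) ?mulf_neq0 //; ring.
have n8 : (8 : F) != 0 by rewrite (_ : 8 = 2 * 4) ?mulf_neq0 //; ring.
split.
  transitivity (- c 0%N / (8 * c 1%N ^+ 3) *
     (4 * c 1%N ^+ 3 + 27 * c 3%N * c 0%N ^+ 2)); last by rewrite D0 mulr0.
  by field; rewrite ?n2 ?n4 ?n8 ?n1.
transitivity ((4 * c 1%N ^+ 2)^-1 *
   (4 * c 1%N ^+ 3 + 27 * c 3%N * c 0%N ^+ 2)); last by rewrite D0 mulr0.
by field; rewrite ?n2 ?n4 ?n8 ?n1.
Qed.
End SmallResiduals.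

(** * Irregular integers and the iteration *)

Section Iteration.
Variables (p : nat) (a b c : int).
Let f := quartic a b c.
Hypothesis pp : prime p.
Hypothesis p_gt3 : (3 < p)%N.
Local Notation A s k := (taylor f s k).
Local Notation w s k := (ordp p (A s k)).
Local Notation pi := (p%:Z).

Let castF (z : int) : (pi %| z)%Z = (z%:~R == 0 :> 'F_p).
Proof. exact: dvdz_pcharf (pchar_Fp pp) z. Qed.

Let p2 : ~~ (pi %| 2)%Z. Proof. by rewrite dvdzE gtnNdvd // ltnW. Qed.
Let p3 : ~~ (pi %| 3)%Z. Proof. by rewrite dvdzE gtnNdvd. Qed.
Let p4 : ~~ (pi %| 4)%Z. Proof. exact: (ndvdzM pp p2 p2). Qed.

Let pX0 k : pi ^+ k != 0.
Proof. by rewrite expf_neq0 // eqz_nat -lt0n prime_gt0. Qed.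

Lemma dvdz_pXS m (z : int) : (pi ^+ m.+1 %| pi ^+ m * z)%Z = (pi %| z)%Z.
Proof. by rewrite exprSr dvdz_mul2l. Qed.

Lemma taylor3_ndvd s : ~~ (pi %| s)%Z -> ~~ (pi %| A s 3)%Z.
Proof. by move=> ps; rewrite taylor3 ndvdzM. Qed.

Lemma taylor4_ndvd s : ~~ (pi %| A s 4)%Z.
Proof. by rewrite taylor4 dvdzE dvdn1 neq_ltn prime_gt1 ?orbT. Qed.

Lemma dvdz_of_ordp (z : int) k : (z != 0 -> k <= ordp p z)%N -> (pi ^+ k %| z)%Z.
Proof.
by have [->|z0] := eqVneq z 0; rewrite ?dvdz0 // dvdz_ordp // => ->.
Qed.

Lemma ordp_unit (z : int) : ~~ (pi %| z)%Z -> ordp p z = 0%N.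
Proof. by move=> pz; rewrite -(mulr1 z) -(expr0 pi) ordp_eq. Qed.

(** Whenever the points of abscissa 0 and 1 are on or above the line of slope -k
    through (3, 0), the point of abscissa 2 is strictly above it. This is what the
    inequality between v(f''(s)/2) and the discriminant says about the polygon. *)
Definition point2_above (s : int) :=
  forall k, (pi ^+ (3 * k) %| A s 0)%Z -> (pi ^+ (2 * k) %| A s 1)%Z ->
    (pi ^+ k.+1 %| A s 2)%Z.

(** A side of slope -mu from (0, 3 mu) to (3, 0), with residual polynomial
    A3 y^3 + B1 y + B0 of discriminant 0. *)
Definition cubic_side s mu B0 B1 B2 :=
  [/\ (0 < mu)%N, A s 0 = pi ^+ (3 * mu) * B0, A s 1 = pi ^+ (2 * mu) * B1,
      A s 2 = pi ^+ mu * B2 &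
      [/\ ~~ (pi %| B0)%Z, ~~ (pi %| B1)%Z, (pi %| B2)%Z &
          (pi %| 4 * B1 ^+ 3 + 27 * A s 3 * B0 ^+ 2)%Z]].

Let o0 : 'I_5 := inord 0. Let o2 : 'I_5 := inord 2. Let o3 : 'I_5 := inord 3.

Lemma quadratic_inseparable_dvd (x y z : int) :
  ~~ separable_poly (\poly_(m < 3) ([:: x; y; z]`_m)%:~R : {poly 'F_p}) ->
  (pi %| y ^+ 2 - 4 * x * z)%Z.
Proof.
move/quadratic_inseparable => /= H; rewrite castF; apply/eqP.
by rewrite -[RHS](subrr ((y%:~R : 'F_p) ^+ 2)) {2}H; ring.
Qed.

(** The sides from 0 to 2 and from 1 to 3 are excluded by the position of the
    point of abscissa 2: in the first case it would be on the line of slope -w_2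
    through (3, 0), with the two earlier points on or above this line; in the
    second the residual polynomial has no linear term. The same position removes the y^2 term on the remaining side. *)
Lemma inseparable_side_start (s : int) (i j : 'I_5) :
  ~~ (pi %| s)%Z -> point2_above s ->
  is_side p f s i j -> ~~ separable_poly (residual_poly p f s i j) ->
  exists mu B0 B1 B2, [/\ i = o0, j = o3, slope p f s i j = - mu%:R,
    cubic_side s mu B0 B1 B2 &
    residual_poly p f s i j = \poly_(m < 4) ([:: B0; B1; B2; A s 3]`_m)%:~R].
Proof.
move=> ps dp sij insep.
have p3' := taylor3_ndvd ps; have w3 : w s 3 = 0%N := ordp_unit p3'.
have A30 : A s 3 != 0 by apply: contra p3' => /eqP ->; rewrite dvdz0.
have [mu slE ij] := inseparable_side pp p3' (taylor4_ndvd s) sij insep.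
have := side_slope_int p f s i j mu; rewrite sij slE eqxx.
case/esym/and5P => lij Ai Aj mu0 /andP [/eqP wij /forallP above].
have ab (k : nat) : (k < 5)%N -> A s k != 0 ->
    (w s i + mu * i <= w s k + mu * k)%N /\
    ((w s i + mu * i = w s k + mu * k)%N -> (i <= k <= j)%N).
  move=> hk Ak; have := above (Ordinal hk); rewrite /= Ak /= => /andP [le e].
  by split=> // /eqP; apply/implyP.
have [B [BE RE Boff [Bi Bj]]] := side_residual_int pp sij slE.
have ab3 := ab 3%N isT A30; have ab2 := ab 2%N isT.
case: ij => -[ei ej].
- have [le3 ne3] := ab3; rewrite ei ej w3 in wij le3 ne3.
  have A2 : A s 2 != 0 by move: Aj; rewrite ej.
  have lt : (w s 0 < mu * 3)%N.
    rewrite ltn_neqAle; apply/andP; split; last by clear -le3; lia.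
    by apply/eqP => e; move: ne3; rewrite e; clear; lia.
  have : (pi ^+ (w s 2).+1 %| A s 2)%Z.
    apply: dp; first by apply: dvdz_of_ordp => _; clear -wij lt; lia.
    by apply: dvdz_of_ordp => A1; have [] := ab 1%N isT A1; rewrite ei; clear -wij lt; lia.
  by rewrite dvdz_ordp // ltnn.
- have cE : (w s i + mu * i = 3 * mu)%N by rewrite ej w3 in wij; clear -wij; lia.
  have dB2 : (pi %| B 2%N)%Z.
    have : (pi ^+ mu.+1 %| A s 2)%Z.
      apply: dp; first by have := BE 0%N isT; rewrite muln0 mulr1 cE => ->; rewrite dvdz_mulr.
      by apply: dvdz_of_ordp => _; rewrite ei in cE; clear -cE; lia.
    rewrite -(@dvdz_mul2r (pi ^+ (mu * 2))) // BE // cE -exprD.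
    have -> : (mu.+1 + mu * 2 = 3 * mu + 1)%N by clear; lia.
    by rewrite exprD dvdz_mul2l // expr1.
  have : (pi %| B 2%N ^+ 2 - 4 * B 1%N * B 3%N)%Z.
    apply: quadratic_inseparable_dvd; move: insep; rewrite RE ei ej.
    by congr (~~ separable_poly _); apply/polyP => -[|[|[|m]]]; rewrite !coef_poly.
  rewrite expr2 rpredBl; last by rewrite dvdz_mull.
  move=> d; rewrite ei in Bi; rewrite ej in Bj.
  by have := ndvdzM pp (ndvdzM pp p4 Bi) Bj; rewrite d.
have cE : (w s i + mu * i = 3 * mu)%N by rewrite ej w3 in wij; clear -wij; lia.
have A0E : A s 0 = pi ^+ (3 * mu) * B 0%N by rewrite -cE -BE // muln0 mulr1.
have A1E : A s 1 = pi ^+ (2 * mu) * B 1%N.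
  apply: (mulIf (pX0 (mu * 1))); rewrite BE // cE mulrAC -exprD.
  by congr (_ ^+ _ * _); clear; lia.
have A2E : A s 2 = pi ^+ mu * B 2%N.
  apply: (mulIf (pX0 (mu * 2))); rewrite BE // cE mulrAC -exprD.
  by congr (_ ^+ _ * _); clear; lia.
have A3E : A s 3 = B 3%N.
  by apply: (mulIf (pX0 (mu * 3))); rewrite BE // cE mulrC (mulnC mu).
have dB2 : (pi %| B 2%N)%Z.
  have : (pi ^+ mu.+1 %| A s 2)%Z.
    by apply: dp; rewrite ?A0E ?A1E dvdz_mulr.
  by rewrite A2E dvdz_pXS.
have RE' : residual_poly p f s i j = \poly_(m < 4) ([:: B 0%N; B 1%N; B 2%N; A s 3]`_m)%:~R.
  rewrite RE ei ej A3E /=; apply/polyP => m; rewrite !coef_poly.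
  by case: m => [|[|[|[|m]]]].
exists mu, (B 0%N), (B 1%N), (B 2%N); split=> //.
- by apply: val_inj; rewrite /= inordK.
- by apply: val_inj; rewrite /= inordK.
have B0 : ~~ (pi %| B 0%N)%Z by move: Bi; rewrite ei.
have dD : (pi %| 4 * B 1%N ^+ 3 + 27 * A s 3 * B 0%N ^+ 2)%Z.
  have B2F : (B 2%N)%:~R = 0 :> 'F_p by apply/eqP; rewrite -castF.
  rewrite RE' in insep.
  have /= H := @cubic_inseparable _
    (fun m => ([:: B 0%N; B 1%N; B 2%N; A s 3]`_m)%:~R : 'F_p) B2F insep.
  by rewrite castF; apply/eqP; rewrite -[RHS]H; ring.
split=> //; split=> //; apply/negP => dB1.
have : (pi %| 27 * A s 3 * B 0%N ^+ 2)%Z.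
  have -> : 27 * A s 3 * B 0%N ^+ 2 = (4 * B 1%N ^+ 3 + 27 * A s 3 * B 0%N ^+ 2)
    - (4 * B 1%N ^+ 2) * B 1%N by ring.
  by rewrite rpredB // dvdz_mull.
apply/negP; rewrite expr2; apply: (ndvdzM pp); last exact: (ndvdzM pp).
by apply: (ndvdzM pp) => //; apply: (ndvdzM pp p3 (ndvdzM pp p3 p3)).
Qed.


(** The polygon after a step: (2, k) is a vertex, followed by a side of slope -k
    from (2, k) to (3, 0), and what precedes it is steeper than -n. *)
Definition iterate_state k n s :=
  [/\ ~~ (pi %| s)%Z, (0 < k <= n)%N,
      (pi ^+ k %| A s 2)%Z && ~~ (pi ^+ k.+1 %| A s 2)%Z,
      (pi ^+ (2 * n + k).+1 %| A s 0)%Z & (pi ^+ (n + k).+1 %| A s 1)%Z].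

(** A side of slope -mu from (0, 2 mu + k) to (2, k), with residual polynomial
    B2 y^2 + B1 y + B0 of discriminant 0. *)
Definition quad_side s k mu B0 B1 B2 :=
  [/\ A s 0 = pi ^+ (2 * mu + k) * B0, A s 1 = pi ^+ (mu + k) * B1,
      A s 2 = pi ^+ k * B2 &
      [/\ ~~ (pi %| B0)%Z, ~~ (pi %| B2)%Z & (pi %| B1 ^+ 2 - 4 * B0 * B2)%Z]].

(** A side of integral slope ending at 3 and starting at 0 or 1 would pass above
    the vertex (2, k). *)
Lemma inseparable_side_iterate (k n : nat) (s : int) (i j : 'I_5) :
  iterate_state k n s ->
  is_side p f s i j -> ~~ separable_poly (residual_poly p f s i j) ->
  exists mu B0 B1 B2, [/\ i = o0, j = o2, slope p f s i j = - mu%:R /\ (n < mu)%N,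
    quad_side s k mu B0 B1 B2 &
    residual_poly p f s i j = \poly_(m < 3) ([:: B0; B1; B2]`_m)%:~R].
Proof.
move=> [ps /andP [k0 kn] /andP [kA2 kA2'] nA0 nA1] sij insep.
have p3' := taylor3_ndvd ps; have w3 : w s 3 = 0%N := ordp_unit p3'.
have A30 : A s 3 != 0 by apply: contra p3' => /eqP ->; rewrite dvdz0.
have A20 : A s 2 != 0 by apply: contra kA2' => /eqP ->; rewrite dvdz0.
have w2 : w s 2 = k.
  by move: kA2 kA2'; rewrite !dvdz_ordp // -ltnNge ltnS => le1 le2; apply/eqP; rewrite eqn_leq le2.
have [mu slE ij] := inseparable_side pp p3' (taylor4_ndvd s) sij insep.
have := side_slope_int p f s i j mu; rewrite sij slE eqxx.
case/esym/and5P => lij Ai Aj mu0 /andP [/eqP wij /forallP above].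
have ab (l : nat) : (l < 5)%N -> A s l != 0 ->
    (w s i + mu * i <= w s l + mu * l)%N.
  by move=> hl Al; have := above (Ordinal hl); rewrite /= Al /= => /andP [].
have [B [BE RE Boff [Bi Bj]]] := side_residual_int pp sij slE.
have le2 := ab 2%N isT A20; rewrite w2 in le2.
case: ij => -[ei ej]; first last.
- have : (2 * n + k < w s 0)%N by rewrite -dvdz_ordp // -ei.
  by rewrite ei ej w3 in wij le2; clear -wij le2 kn; lia.
- have : (n + k < w s 1)%N by rewrite -dvdz_ordp // -ei.
  by rewrite ei ej w3 in wij le2; clear -wij le2 kn; lia.
have ltn : (n < mu)%N.
  have : (2 * n + k < w s 0)%N by rewrite -dvdz_ordp // -ei.
  by rewrite ei ej w2 in wij le2; clear -wij kn; lia.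
have cE : (w s i + mu * i = 2 * mu + k)%N by rewrite ej w2 in wij; clear -wij; lia.
have A0E : A s 0 = pi ^+ (2 * mu + k) * B 0%N by rewrite -cE -BE // muln0 mulr1.
have A1E : A s 1 = pi ^+ (mu + k) * B 1%N.
  apply: (mulIf (pX0 (mu * 1))); rewrite BE // cE mulrAC -exprD.
  by congr (_ ^+ _ * _); clear; lia.
have A2E : A s 2 = pi ^+ k * B 2%N.
  apply: (mulIf (pX0 (mu * 2))); rewrite BE // cE mulrAC -exprD.
  by congr (_ ^+ _ * _); clear; lia.
have RE' : residual_poly p f s i j = \poly_(m < 3) ([:: B 0%N; B 1%N; B 2%N]`_m)%:~R.
  rewrite RE ei ej /=; apply/polyP => m; rewrite !coef_poly.
  by case: m => [|[|[|m]]].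
exists mu, (B 0%N), (B 1%N), (B 2%N); split=> //.
- by apply: val_inj; rewrite /= inordK.
- by apply: val_inj; rewrite /= inordK.
rewrite ei in Bi; rewrite ej in Bj; do 2!split=> //.
by apply: quadratic_inseparable_dvd; rewrite -RE'.
Qed.

Let c2F : (2 : 'F_p) != 0.
Proof. by have := p2; rewrite castF. Qed.

Lemma cubic_side_irregular s mu B0 B1 B2 : ~~ (pi %| s)%Z ->
  cubic_side s mu B0 B1 B2 -> ~~ regular_int p f s.
Proof.
move=> ps [mu0 A0E A1E A2E [B00 B10 B20 D0]].
have p3' := taylor3_ndvd ps; have w3 : w s 3 = 0%N := ordp_unit p3'.
have A30 : A s 3 != 0 by apply: contra p3' => /eqP ->; rewrite dvdz0.
have w0 : w s 0 = (3 * mu)%N by rewrite A0E mulrC ordp_eq.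
have A00 : A s 0 != 0.
  by rewrite A0E mulf_neq0 //; apply: contra B00 => /eqP ->; rewrite dvdz0.
have /andP [sij /eqP slE] : is_side p f s o0 o3 && (slope p f s o0 o3 == - mu%:R).
  rewrite side_slope_int; rewrite /o0 /o3 !inordK // w0 w3 A00 A30 mu0 /=.
  rewrite muln0 addn0 add0n mulnC eqxx /=; apply/forallP => -[l hl] /=.
  apply/implyP; case: l hl => [|[|[|[|[|l]]]]] //= hl Al.
  - by rewrite w0 muln0 addn0 mulnC leqnn implybT.
  - rewrite implybT andbT.
    have : (2 * mu <= w s 1)%N by rewrite -dvdz_ordp // A1E dvdz_mulr.
    clear; lia.
  - rewrite implybT andbT.
    have : (mu <= w s 2)%N by rewrite -dvdz_ordp // A2E dvdz_mulr.
    clear; lia.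
  - by rewrite w3 add0n leqnn implybT.
  - by rewrite (ordp_unit (taylor4_ndvd s)); clear -mu0; lia.
rewrite /regular_int negb_forall; apply/existsP; exists o0.
rewrite negb_forall; apply/existsP; exists o3; rewrite sij /=.
have [B [BE RE _ _]] := side_residual_int pp sij slE.
rewrite /o0 !inordK // w0 muln0 addn0 in BE.
have b0 : B 0%N = B0.
  by apply: (mulfI (pX0 (3 * mu))); rewrite -BE // muln0 mulr1 A0E.
have b1 : B 1%N = B1.
  apply: (mulfI (pX0 (3 * mu))); rewrite -BE // A1E mulrAC -exprD.
  by congr (_ ^+ _ * _); clear; lia.
have b2 : B 2%N = B2.
  apply: (mulfI (pX0 (3 * mu))); rewrite -BE // A2E mulrAC -exprD.
  by congr (_ ^+ _ * _); clear; lia.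
have b3 : B 3%N = A s 3.
  by apply: (mulfI (pX0 (3 * mu))); rewrite -BE // mulrC (mulnC mu).
rewrite RE /o0 /o3 !inordK //; have [] := @cubic_double_root _ (fun m => (B (0 + m)%N)%:~R : 'F_p) c2F.
- by rewrite /= add0n b1 -castF.
- by apply/eqP; rewrite /= add0n b2 -castF.
- rewrite /= !add0n b0 b1 b3; apply/eqP; move: D0; rewrite castF.
  by congr (_ == 0); ring.
by move=> y [r0 r1]; apply: double_root_not_separable r0 r1.
Qed.

Lemma quad_side_irregular s k n mu B0 B1 B2 : iterate_state k n s -> (k < mu)%N ->
  quad_side s k mu B0 B1 B2 -> ~~ regular_int p f s.
Proof.
move=> [ps _ /andP [_ kA2] _ _] kmu [A0E A1E A2E [B00 B20 D0]].
have p3' := taylor3_ndvd ps; have w3 : w s 3 = 0%N := ordp_unit p3'.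
have w0 : w s 0 = (2 * mu + k)%N by rewrite A0E mulrC ordp_eq.
have w2 : w s 2 = k by rewrite A2E mulrC ordp_eq.
have A00 : A s 0 != 0.
  by rewrite A0E mulf_neq0 //; apply: contra B00 => /eqP ->; rewrite dvdz0.
have A20 : A s 2 != 0 by apply: contra kA2 => /eqP ->; rewrite dvdz0.
have mu0 : (0 < mu)%N by apply: leq_ltn_trans kmu.
have /andP [sij /eqP slE] : is_side p f s o0 o2 && (slope p f s o0 o2 == - mu%:R).
  rewrite side_slope_int; rewrite /o0 /o2 !inordK // w0 w2 A00 A20 mu0 /=.
  have -> : (2 * mu + k + mu * 0 = k + mu * 2)%N by clear; lia.
  rewrite eqxx /=; apply/forallP => -[l hl] /=.
  apply/implyP; case: l hl => [|[|[|[|[|l]]]]] //= hl Al.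
  - by rewrite w0 implybT; clear; lia.
  - rewrite implybT andbT.
    have : (mu + k <= w s 1)%N by rewrite -dvdz_ordp // A1E dvdz_mulr.
    clear; lia.
  - by rewrite w2 leqnn implybT.
  - by rewrite w3; clear -kmu; lia.
  - by rewrite (ordp_unit (taylor4_ndvd s)); clear -kmu; lia.
rewrite /regular_int negb_forall; apply/existsP; exists o0.
rewrite negb_forall; apply/existsP; exists o2; rewrite sij /=.
have [B [BE RE _ _]] := side_residual_int pp sij slE.
rewrite /o0 !inordK // w0 muln0 addn0 in BE.
have b0 : B 0%N = B0.
  by apply: (mulfI (pX0 (2 * mu + k))); rewrite -BE // muln0 mulr1 A0E.
have b1 : B 1%N = B1.
  apply: (mulfI (pX0 (2 * mu + k))); rewrite -BE // A1E mulrAC -exprD.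
  by congr (_ ^+ _ * _); clear; lia.
have b2 : B 2%N = B2.
  apply: (mulfI (pX0 (2 * mu + k))); rewrite -BE // A2E mulrAC -exprD.
  by congr (_ ^+ _ * _); clear; lia.
rewrite RE /o0 /o2 !inordK //; have [] := @quadratic_double_root _ (fun m => (B (0 + m)%N)%:~R : 'F_p) c2F.
- by rewrite /= add0n b2 -castF.
- rewrite /= !add0n b0 b1 b2; apply/eqP; move: D0; rewrite castF.
  by congr (_ == 0); ring.
by move=> y [r0 r1]; apply: double_root_not_separable r0 r1.
Qed.

Lemma residual_roots (R : {poly 'F_p}) (y : 'F_p) : (1 < mup y R)%N -> R`_0 != 0 ->
  [/\ R.[y] = 0, R^`().[y] = 0 & ~~ separable_poly R].
Proof.
move=> m1 R0; have Rn0 : R != 0 by apply: contra R0 => /eqP ->; rewrite coef0.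
move: m1; rewrite double_rootP // => /andP [/eqP r0 /eqP r1].
by split=> //; apply: (double_root_not_separable r0 r1).
Qed.

Lemma side_residual0 (s : int) (i j : 'I_5) mu : is_side p f s i j ->
  slope p f s i j = - mu%:R -> (residual_poly p f s i j)`_0 != 0.
Proof.
move=> sij slE; have [B [_ -> _ [Bi _]]] := side_residual_int pp sij slE.
by rewrite coef_poly /= addn0 -castF.
Qed.

Let mu_inj (m n : nat) : - m%:R = - n%:R :> rat -> m = n.
Proof. by move/oppr_inj/eqP; rewrite eqr_nat => /eqP. Qed.

(** Translating by y p^mu, with y a double root of the residual polynomial, raises
    the valuations of A_0 and A_1. The double root is nonzero and not a triple
    one, so A_2 becomes a unit times p^mu. *)
Lemma cubic_step s s' : ~~ (pi %| s)%Z -> point2_above s -> iteration_step p f s s' ->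
  exists mu B0 B1 B2, cubic_side s mu B0 B1 B2 /\ iterate_state mu mu s'.
Proof.
move=> ps dp [i [j [mu [y [sij slE m1 ->]]]]].
have [r0 r1 insep] := residual_roots m1 (side_residual0 sij slE).
have [mu' [B0 [B1 [B2 [_ _ slE' cs RE]]]]] := inseparable_side_start ps dp sij insep.
have emu : mu' = mu by apply: mu_inj; rewrite -slE'.
rewrite {mu' slE'}emu in cs; exists mu, B0, B1, B2; split=> //.
have [mu0 A0E A1E A2E [B00 B10 B20 D0]] := cs.
have R0 : (pi %| A s 3 * y ^+ 3 + B2 * y ^+ 2 + B1 * y + B0)%Z.
  rewrite castF; apply/eqP; rewrite -[RHS]r0 RE poly4_double_root /=; ring.
have R1 : (pi %| 3 * A s 3 * y ^+ 2 + 2 * B2 * y + B1)%Z.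
  rewrite castF; apply/eqP; rewrite -[RHS]r1 RE poly4_double_root /=; ring.
have py : ~~ (pi %| y)%Z.
  apply: contra B00 => yd.
  have -> : B0 = (A s 3 * y ^+ 3 + B2 * y ^+ 2 + B1 * y + B0)
    - (A s 3 * y ^+ 2 + B2 * y + B1) * y by ring.
  by rewrite rpredB // dvdz_mull.
have pmu : (pi %| pi ^+ mu)%Z by rewrite -(prednK mu0) exprS dvdz_mulr.
split.
- by apply: contra ps => d; rewrite -(addrK (y * pi ^+ mu) s) rpredB // dvdz_mull.
- by rewrite mu0 leqnn.
- rewrite taylor2_translate A2E.
  have -> : pi ^+ mu * B2 + 3 * A s 3 * (y * pi ^+ mu) + 6 * (y * pi ^+ mu) ^+ 2
    = pi ^+ mu * (B2 + 3 * A s 3 * y + 6 * y ^+ 2 * pi ^+ mu) by ring.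
  rewrite dvdz_mulr // dvdz_pXS.
  apply: contra (ndvdzM pp (ndvdzM pp p3 (taylor3_ndvd ps)) py) => d.
  have -> : 3 * A s 3 * y = (B2 + 3 * A s 3 * y + 6 * y ^+ 2 * pi ^+ mu) - B2
    - 6 * y ^+ 2 * pi ^+ mu by ring.
  by rewrite rpredB ?dvdz_mull // rpredB.
- rewrite taylor0_translate A0E A1E A2E.
  have -> : pi ^+ (3 * mu) * B0 + pi ^+ (2 * mu) * B1 * (y * pi ^+ mu)
    + pi ^+ mu * B2 * (y * pi ^+ mu) ^+ 2 + A s 3 * (y * pi ^+ mu) ^+ 3
    + (y * pi ^+ mu) ^+ 4
    = pi ^+ (2 * mu + mu) * ((A s 3 * y ^+ 3 + B2 * y ^+ 2 + B1 * y + B0)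
       + y ^+ 4 * pi ^+ mu).
    have -> : (3 * mu = mu + mu + mu)%N by clear; lia.
    by rewrite mul2n -addnn !exprD; ring.
  by rewrite dvdz_pXS rpredD // dvdz_mull.
rewrite taylor1_translate A1E A2E.
have -> : pi ^+ (2 * mu) * B1 + 2 * (pi ^+ mu * B2) * (y * pi ^+ mu)
  + 3 * A s 3 * (y * pi ^+ mu) ^+ 2 + 4 * (y * pi ^+ mu) ^+ 3
  = pi ^+ (mu + mu) * ((3 * A s 3 * y ^+ 2 + 2 * B2 * y + B1) + 4 * y ^+ 3 * pi ^+ mu).
  by rewrite mul2n -addnn !exprD; ring.
by rewrite dvdz_pXS rpredD // dvdz_mull.
Qed.

(** Now mu exceeds k, so the translation does not change the valuation of A_2. *)
Lemma quad_step k n s s' : iterate_state k n s -> iteration_step p f s s' ->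
  exists2 mu, (n < mu)%N & iterate_state k mu s'.
Proof.
move=> st [i [j [mu [y [sij slE m1 ->]]]]].
have [r0 r1 insep] := residual_roots m1 (side_residual0 sij slE).
have [mu' [B0 [B1 [B2 [_ _ [slE' nmu] cs RE]]]]] := inseparable_side_iterate st sij insep.
have emu : mu' = mu by apply: mu_inj; rewrite -slE'.
rewrite {mu' slE'}emu in cs nmu; exists mu => //.
have [A0E A1E A2E [B00 B20 D0]] := cs.
have [ps /andP [k0 kn] /andP [kA2 kA2'] nA0 nA1] := st.
have kmu : (k < mu)%N by apply: leq_ltn_trans nmu.
have R0 : (pi %| B2 * y ^+ 2 + B1 * y + B0)%Z.
  rewrite castF; apply/eqP; rewrite -[RHS]r0 RE poly3_double_root /=; ring.
have R1 : (pi %| 2 * B2 * y + B1)%Z.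
  rewrite castF; apply/eqP; rewrite -[RHS]r1 RE poly3_double_root /=; ring.
have pX m : (0 < m)%N -> (pi %| pi ^+ m)%Z.
  by move=> m0; rewrite -(prednK m0) exprS dvdz_mulr.
have pmk : (pi %| pi ^+ (mu - k))%Z by rewrite pX // subn_gt0.
have pmu : (pi %| pi ^+ mu)%Z by rewrite pX // (leq_ltn_trans _ nmu).
have muE : pi ^+ mu = pi ^+ k * pi ^+ (mu - k) by rewrite -exprD subnKC // ltnW.
split.
- by apply: contra ps => d; rewrite -(addrK (y * pi ^+ mu) s) rpredB // dvdz_mull.
- by rewrite k0 ltnW.
- rewrite taylor2_translate A2E muE.
  have -> : pi ^+ k * B2 + 3 * A s 3 * (y * (pi ^+ k * pi ^+ (mu - k)))
    + 6 * (y * (pi ^+ k * pi ^+ (mu - k))) ^+ 2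
    = pi ^+ k * (B2 + (3 * A s 3 * y + 6 * y ^+ 2 * pi ^+ k * pi ^+ (mu - k)) * pi ^+ (mu - k))
    by ring.
  rewrite dvdz_mulr // dvdz_pXS; apply: contra B20 => d.
  rewrite -(addrK ((3 * A s 3 * y + 6 * y ^+ 2 * pi ^+ k * pi ^+ (mu - k)) * pi ^+ (mu - k)) B2).
  by rewrite rpredB // dvdz_mull.
- rewrite taylor0_translate A0E A1E A2E.
  have -> : pi ^+ (2 * mu + k) * B0 + pi ^+ (mu + k) * B1 * (y * pi ^+ mu)
    + pi ^+ k * B2 * (y * pi ^+ mu) ^+ 2 + A s 3 * (y * pi ^+ mu) ^+ 3
    + (y * pi ^+ mu) ^+ 4
    = pi ^+ (2 * mu + k) * ((B2 * y ^+ 2 + B1 * y + B0)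
       + (A s 3 * y ^+ 3 + y ^+ 4 * pi ^+ mu) * pi ^+ (mu - k)).
    by rewrite mul2n -addnn !exprD muE; ring.
  by rewrite dvdz_pXS rpredD // dvdz_mull.
rewrite taylor1_translate A1E A2E.
have -> : pi ^+ (mu + k) * B1 + 2 * (pi ^+ k * B2) * (y * pi ^+ mu)
  + 3 * A s 3 * (y * pi ^+ mu) ^+ 2 + 4 * (y * pi ^+ mu) ^+ 3
  = pi ^+ (mu + k) * ((2 * B2 * y + B1)
     + (3 * A s 3 * y ^+ 2 + 4 * y ^+ 3 * pi ^+ mu) * pi ^+ (mu - k)).
  by rewrite !exprD muE; ring.
by rewrite dvdz_pXS rpredD // dvdz_mull.
Qed.


Lemma irregular_side s : ~~ regular_int p f s -> exists i j : 'I_5,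
  is_side p f s i j /\ ~~ separable_poly (residual_poly p f s i j).
Proof.
rewrite /regular_int negb_forall => /existsP [i].
rewrite negb_forall => /existsP [j]; rewrite negb_imply => /andP [sij insep].
by exists i, j.
Qed.

Lemma step_of_double_root s (i j : 'I_5) mu (y : 'F_p) :
  is_side p f s i j -> slope p f s i j = - mu%:R ->
  (residual_poly p f s i j).[y] = 0 -> (residual_poly p f s i j)^`().[y] = 0 ->
  exists s', iteration_step p f s s'.
Proof.
move=> sij slE r0 r1; exists (s + (nat_of_ord y)%:Z * pi ^+ mu), i, j, mu, (nat_of_ord y)%:Z.
split=> //; have -> : (nat_of_ord y)%:Z%:~R = y :> 'F_p by rewrite -pmulrn natr_Zp.
rewrite double_rootP ?r0 ?r1 ?eqxx //.
by have := side_residual0 sij slE; apply: contra => /eqP ->; rewrite coef0.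
Qed.

Lemma start_has_step s : ~~ (pi %| s)%Z -> point2_above s -> ~~ regular_int p f s ->
  exists s', iteration_step p f s s'.
Proof.
move=> ps dp /irregular_side [i [j [sij insep]]].
have [mu [B0 [B1 [B2 [_ _ slE cs RE]]]]] := inseparable_side_start ps dp sij insep.
have [mu0 _ _ _ [B00 B10 B20 D0]] := cs.
have [] := @cubic_double_root _ (fun m => ([:: B0; B1; B2; A s 3]`_m)%:~R : 'F_p) c2F.
- by rewrite /= -castF.
- by apply/eqP; rewrite /= -castF.
- by rewrite /=; apply/eqP; move: D0; rewrite castF; congr (_ == 0); ring.
by move=> y []; rewrite -RE; apply: step_of_double_root slE.
Qed.

Lemma iterate_has_step k n s : iterate_state k n s -> ~~ regular_int p f s ->
  exists s', iteration_step p f s s'.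
Proof.
move=> st /irregular_side [i [j [sij insep]]].
have [mu [B0 [B1 [B2 [_ _ [slE _] cs RE]]]]] := inseparable_side_iterate st sij insep.
have [_ _ _ [B00 B20 D0]] := cs.
have [] := @quadratic_double_root _ (fun m => ([:: B0; B1; B2]`_m)%:~R : 'F_p) c2F.
- by rewrite /= -castF.
- by rewrite /=; apply/eqP; move: D0; rewrite castF; congr (_ == 0); ring.
by move=> y []; rewrite -RE; apply: step_of_double_root slE.
Qed.

Hypothesis disc0 : disc f != 0.

(** The bound that makes the iteration finite: each term of the discriminant
    contains one of the two lowest Taylor coefficients. *)
Lemma iterate_bound k n s : iterate_state k n s -> (n < ordp p (disc f))%N.
Proof.
move=> [_ _ _ nA0 nA1]; rewrite -dvdz_ordp //.
have dX (m : nat) (z : int) : (n < m)%N -> (pi ^+ m %| z)%Z -> (pi ^+ n.+1 %| z)%Z.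
  by move=> nm; apply: dvdz_trans; rewrite -(subnK nm) exprD dvdz_mull.
have {}nA0 : (pi ^+ n.+1 %| A s 0)%Z by apply: dX nA0; clear; lia.
have {}nA1 : (pi ^+ n.+1 %| A s 1)%Z by apply: dX nA1; clear; lia.
rewrite (disc_taylor _ _ _ s); have /dvdzP [x ->] := nA0; have /dvdzP [y ->] := nA1.
set P := pi ^+ n.+1; set A3 := A s 3; set A2 := A s 2.
have -> : quartic_disc A3 A2 (y * P) (x * P)
  = (256 * x ^+ 3 * P ^+ 2 - 192 * A3 * y * x ^+ 2 * P ^+ 2 - 128 * A2 ^+ 2 * x ^+ 2 * P
     + 144 * A2 * y ^+ 2 * x * P ^+ 2 - 27 * y ^+ 4 * P ^+ 3
     + 144 * A3 ^+ 2 * A2 * x ^+ 2 * P - 6 * A3 ^+ 2 * y ^+ 2 * x * P ^+ 2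
     - 80 * A3 * A2 ^+ 2 * y * x * P + 18 * A3 * A2 * y ^+ 3 * P ^+ 2
     + 16 * A2 ^+ 4 * x - 4 * A2 ^+ 3 * y ^+ 2 * P - 27 * A3 ^+ 4 * x ^+ 2 * P
     + 18 * A3 ^+ 3 * A2 * y * x * P - 4 * A3 ^+ 3 * y ^+ 3 * P ^+ 2
     - 4 * A3 ^+ 2 * A2 ^+ 3 * x + A3 ^+ 2 * A2 ^+ 2 * y ^+ 2 * P) * P.
  by rewrite /quartic_disc; ring.
by rewrite dvdz_mull.
Qed.

Lemma iterate_terminates k n s : iterate_state k n s -> iteration_terminates p f s.
Proof.
move: {2}(ordp p (disc f) - n)%N (leqnn (ordp p (disc f) - n)) => N.
elim: N n s => [|N IH] n s le st.
  by have := iterate_bound st; clear -le; lia.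
have [reg|irr] := boolP (regular_int p f s).
  exact: iteration_terminates_regular.
apply: iteration_terminates_irregular => //; first exact: iterate_has_step st irr.
move=> s' /(quad_step st) [mu nmu st']; apply: (IH mu) st'.
by have := iterate_bound st; clear -le nmu; lia.
Qed.

Lemma start_terminates s : ~~ (pi %| s)%Z -> point2_above s -> iteration_terminates p f s.
Proof.
move=> ps dp; have [reg|irr] := boolP (regular_int p f s).
  exact: iteration_terminates_regular.
apply: iteration_terminates_irregular => //; first exact: start_has_step.
by move=> s' /(cubic_step ps dp) [mu [_ [_ [_ [_ st]]]]]; apply: iterate_terminates st.
Qed.

Lemma iterate_result k n s t : iterate_state k n s -> iteration_result p f s t ->
  regular_int p f t /\ exists n', iterate_state k n' t.
Proof.
move=> st res; elim: res n st => [u reg | u u' v irr stp _ IH] n st.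
  by split=> //; exists n.
by have [mu _ st'] := quad_step st stp; apply: IH st'.
Qed.

Lemma start_result s t : ~~ (pi %| s)%Z -> point2_above s -> iteration_result p f s t ->
  regular_int p f t /\
  (t = s \/ exists mu B0 B1 B2 n, cubic_side s mu B0 B1 B2 /\ iterate_state mu n t).
Proof.
move=> ps dp res; case: res ps dp => [u reg ps dp | u u' v irr stp res ps dp].
  by split=> //; left.
have [mu [B0 [B1 [B2 [cs st]]]]] := cubic_step ps dp stp.
have [reg [n' st']] := iterate_result st res.
by split=> //; right; exists mu, B0, B1, B2, n'.
Qed.

Lemma start_irregularP s : ~~ (pi %| s)%Z -> point2_above s ->
  ~~ regular_int p f s <-> exists mu B0 B1 B2, cubic_side s mu B0 B1 B2.
Proof.
move=> ps dp; split; last first.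
  by move=> [mu [B0 [B1 [B2 cs]]]]; apply: cubic_side_irregular cs.
move=> /irregular_side [i [j [sij insep]]].
have [mu [B0 [B1 [B2 [_ _ _ cs _]]]]] := inseparable_side_start ps dp sij insep.
by exists mu, B0, B1, B2.
Qed.

(** Otherwise, with w = v(A2), the polynomial would be reduced by P = p^w in the
    sense of [quartic_disc_scaled], and the discriminant divisible by p^(6 w). *)
Lemma point2_above_of_disc s :
  (A s 2 != 0 -> ordp p (disc f) < 6 * w s 2)%N -> point2_above s.
Proof.
move=> lt k /dvdzP [k0 A0E] /dvdzP [a1 A1E].
apply: dvdz_of_ordp => A20; have {}lt := lt A20; rewrite ltnNge; apply/negP => le.
have : (pi ^+ (6 * w s 2) %| disc f)%Z.
  have PX (m : nat) : exists X, pi ^+ (m * k) = (pi ^+ w s 2) ^+ m * X.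
    exists (pi ^+ (m * (k - w s 2))); rewrite -exprM -exprD; congr (_ ^+ _).
    by rewrite [(w s 2 * m)%N]mulnC -mulnDr subnKC.
  have [X3 E3] := PX 3%N; have [X2 E2] := PX 2%N.
  have A2E : A s 2 = pi ^+ w s 2 * unit_part p (A s 2) by rewrite mulrC unit_partE.
  rewrite (disc_taylor _ _ _ s) A0E A1E [in X in (_ %| X)%Z]A2E E3 E2 (mulnC 6) exprM.
  move: (pi ^+ w s 2) (unit_part p (A s 2)) => P b2.
  have -> : k0 * (P ^+ 3 * X3) = P ^+ 3 * 1 ^+ 2 * (k0 * X3).
    by rewrite expr1n mulr1 mulrCA.
  have -> : a1 * (P ^+ 2 * X2) = P ^+ 2 * 1 * (a1 * X2) by rewrite mulr1 mulrCA.
  by rewrite quartic_disc_scaled -mulrA dvdz_mulr.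
by rewrite dvdz_ordp // leqNgt lt.
Qed.

End Iteration.

(** * Local orders without proper integral extension *)

Section Criterion.
Variables (p : nat) (a b c : int).
Let f := quartic a b c.
Hypothesis pp : prime p.
Hypothesis p_gt3 : (3 < p)%N.
Local Notation A s k := (taylor f s k).
Local Notation w s k := (ordp p (A s k)).
Local Notation pi := (p%:Z).

Let p2 : ~~ (pi %| 2)%Z. Proof. by rewrite dvdzE gtnNdvd // ltnW. Qed.
Let p3 : ~~ (pi %| 3)%Z. Proof. by rewrite dvdzE gtnNdvd. Qed.
Let p4 : ~~ (pi %| 4)%Z. Proof. exact: (ndvdzM pp p2 p2). Qed.
Let p27 : ~~ (pi %| 27)%Z. Proof. exact: (ndvdzM pp p3 (ndvdzM pp p3 p3)). Qed.
Let pX0 k : pi ^+ k != 0.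
Proof. by rewrite expf_neq0 // eqz_nat -lt0n prime_gt0. Qed.
Let pX k : (0 < k)%N -> (pi %| pi ^+ k)%Z.
Proof. by move=> k0; rewrite -(prednK k0) exprS dvdz_mulr. Qed.

(** The order with P = p^k and h = p^e is defined at s, and one of the three
    criteria of saturation holds. *)
Definition closed_order (s : int) (k e : nat) (b2 a1 k0 : int) : Prop :=
  let P := pi ^+ k in let h := pi ^+ e in
  [/\ A s 2 = P * b2, A s 1 = P ^+ 2 * h * a1, A s 0 = P ^+ 3 * h ^+ 2 * k0,
      [/\ (pi %| P * h * k0)%Z, (pi %| P * h * a1)%Z & (pi %| P * b2)%Z] &
      [\/ ~~ (pi %| cubic_disc (4 * s * h) b2 a1 k0)%Z,
          [/\ (pi %| a1)%Z, (pi %| k0)%Z, ~~ (pi ^+ 2 %| k0)%Z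
             & ~~ (pi %| b2)%Z || ~~ (pi %| h)%Z]
        | [/\ (pi %| b2)%Z, (pi %| h)%Z, ~~ (pi ^+ 2 %| h)%Z
             & ~~ (pi %| a1)%Z || ~~ (pi %| k0)%Z]]].

Lemma closed_order_basis (K : fieldExtType rat) (theta : K) (s : int) k e b2 a1 k0 :
  irreducible_poly f -> root (map_poly intr f) theta -> <<1%VS; theta>>%VS = fullv ->
  ~~ (pi %| s)%Z -> closed_order s k e b2 a1 k0 ->
  pintegral_basis p
    [tuple 1; theta;
       (theta ^+ 2 + 2 * s%:~R * theta + (3 * s ^+ 2 + a)%:~R) / p%:R ^ k%:Z;
       (theta ^+ 3 + s%:~R * theta ^+ 2 + (s ^+ 2 + a)%:~R * theta
          + (s ^+ 3 + a * s + b)%:~R) / p%:R ^ (2 * k + e)%N%:Z].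
Proof.
move=> f_irr f_root full ps [A2E A1E A0E [d1 d2 d3] crit].
rewrite /f taylor2 in A2E; rewrite /f taylor1 in A1E; rewrite /f taylor0 in A0E.
have := taylor_order_basis pp p_gt3 f_irr f_root full ps (pX0 k) (pX0 e) A2E A1E A0E
   d1 d2 d3 crit.
have -> : (pi ^+ k)%:~R = p%:R ^ k%:Z :> K by rewrite rmorphXn.
have -> // : ((pi ^+ k) ^+ 2 * pi ^+ e)%:~R = p%:R ^ (2 * k + e)%N%:Z :> K.
by rewrite -exprM -exprD mulnC rmorphXn.
Qed.

Lemma pXn0 k : (pi %| pi ^+ k)%Z = (0 < k)%N.
Proof.
case: k => [|k]; last by rewrite pX.
by rewrite expr0 dvdzE dvdn1 gtn_eqF // prime_gt1.
Qed.

Lemma pX2n k : (pi ^+ 2 %| pi ^+ k)%Z = (1 < k)%N.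
Proof.
rewrite dvdz_ordp //; congr (_ < _)%N; rewrite -(mul1r (pi ^+ k)) ordp_eq //.
by rewrite dvdzE dvdn1 gtn_eqF // prime_gt1.
Qed.

Lemma ordp_disc_scaled (s : int) k e n b2 a1 k0 m :
  A s 2 = pi ^+ k * b2 -> A s 1 = (pi ^+ k) ^+ 2 * pi ^+ e * a1 ->
  A s 0 = (pi ^+ k) ^+ 3 * (pi ^+ e) ^+ 2 * k0 ->
  A s 3 ^+ 2 * cubic_disc (A s 3 * pi ^+ e) b2 a1 k0
    + pi ^+ k * disc_rest (A s 3) (pi ^+ k) (pi ^+ e) b2 a1 k0 = m * pi ^+ n ->
  ~~ (pi %| m)%Z -> ordp p (disc f) = (6 * k + 2 * e + n)%N.
Proof.
move=> A2E A1E A0E E pm; rewrite (disc_taylor _ _ _ s) A2E A1E A0E quartic_disc_scaled E.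
rewrite -!exprM mulrCA -!exprD ordp_eq //; clear; lia.
Qed.

(** The polygon has the single side from (0, w_0) to (3, 0), and the point of
    abscissa 1 is strictly above it. With w_0 = 3 k + r, the three values of r give
    an unramified order and the two shapes of total ramification of the cubic part:
    the reduced form is congruent to A3 h X^3 + k0 Y^3, where A3 h and k0 are units
    (r = 0), only k0 is exactly divisible by p (r = 1), or only A3 h is (r = 2). *)
Lemma closed_order_steep (s : int) : ~~ (pi %| s)%Z -> point2_above p a b c s ->
  A s 0 != 0 -> (pi %| A s 0)%Z -> (A s 1 != 0 -> 2 * w s 0 < 3 * w s 1)%N ->
  exists e b2 a1 k0, closed_order s (w s 0 %/ 3) e b2 a1 k0 /\
    ((2 * w s 0) %/ 3 = 2 * (w s 0 %/ 3) + e)%N.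
Proof.
move=> ps dp A00 pA0 lt.
have w0 : (0 < w s 0)%N by rewrite -dvdz_ordp // expr1.
pose k := (w s 0 %/ 3)%N; pose r := (w s 0 %% 3)%N.
have wE : w s 0 = (3 * k + r)%N by rewrite /k /r mulnC -divn_eq.
have r3 : (r < 3)%N by rewrite ltn_mod.
have [u0 [pu A0E]] : exists u0, ~~ (pi %| u0)%Z /\ A s 0 = u0 * pi ^+ (3 * k + r).
  by exists (unit_part p (A s 0)); rewrite unit_part_ndvd // -wE unit_partE.
have d1 : (pi ^+ (2 * k + (r == 2%N) + 1) %| A s 1)%Z.
  apply: dvdz_of_ordp => // A1; have := lt A1; rewrite wE.
  by case: r r3 {wE A0E} => [|[|[|r]]] //= _; clear; lia.
have [a1 A1E] : exists a1, A s 1 = (pi ^+ k) ^+ 2 * pi ^+ (r == 2%N) * (pi * a1).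
  have /dvdzP [a1 ->] := d1; exists a1.
  by rewrite -exprM -exprD exprD expr1 (mulnC k) mulrC mulrA.
have [b2 A2E] : exists b2, A s 2 = pi ^+ k * (pi * b2).
  have /dvdzP [b2 ->] : (pi ^+ k.+1 %| A s 2)%Z.
    apply: dp; first by rewrite A0E exprD mulrCA dvdz_mulr.
    by rewrite A1E -exprM (mulnC k) -mulrA dvdz_mulr.
  by exists b2; rewrite exprSr mulrC mulrA.
exists (r == 2%N), (pi * b2), (pi * a1).
exists (if r == 1%N then u0 * pi else u0); rewrite -/k; split; last first.
  by rewrite wE; case: r r3 {wE A0E d1 A1E} => [|[|[|r]]] //= _; clear; lia.
have db : (pi %| pi * b2)%Z by rewrite dvdz_mulr.
have da : (pi %| pi * a1)%Z by rewrite dvdz_mulr.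
move: r r3 wE A0E A1E {d1} => [|[|[|r]]] //= _ wE A0E A1E; split=> //.
- by rewrite A0E expr1n mulr1 -exprM addn0 mulrC (mulnC k).
- by split; rewrite ?(dvdz_mull _ db) ?(dvdz_mull _ da) // expr0 mulr1 dvdz_mulr // pXn0;
    move: wE w0; clear; lia.
- constructor 1.
  have -> : cubic_disc (4 * s * pi ^+ 0) (pi * b2) (pi * a1) u0
    = pi * (pi ^+ 3 * b2 ^+ 2 * a1 ^+ 2 - 16 * s * pi ^+ 2 * a1 ^+ 3
            - 4 * pi ^+ 2 * b2 ^+ 3 * u0 + 72 * s * pi * b2 * a1 * u0)
      - 27 * (4 * s) * (4 * s) * (u0 * u0) by rewrite /cubic_disc expr0; ring.
  rewrite rpredBl; last by rewrite dvdz_mulr.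
  have p4s := ndvdzM pp p4 ps.
  exact: (ndvdzM pp (ndvdzM pp (ndvdzM pp p27 p4s) p4s) (ndvdzM pp pu pu)).
- by rewrite A0E expr1n mulr1 -exprM (mulnC k) addn1 exprSr mulrCA mulrA.
- by split; rewrite ?(dvdz_mull _ db) ?(dvdz_mull _ da) // mulrA dvdz_mull.
- constructor 2; split=> //; first by rewrite dvdz_mull.
    by rewrite expr2 dvdz_mul2r // -(expr1 pi).
  by rewrite pXn0 orbT.
- by rewrite A0E -!exprM -exprD (mulnC k) mulrC.
- have dP : (pi %| pi ^+ k * pi ^+ 1)%Z by rewrite dvdz_mull // pXn0.
  by split; rewrite ?(dvdz_mulr _ dP) // dvdz_mull.
constructor 3; split=> //; rewrite ?pXn0 ?pX2n //.
by rewrite pu orbT.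
Qed.

(** The point of abscissa 1 is on or below the line from (0, w_0) to (3, 0). With
    w_1 = 2 k + r, the reduced form is congruent to A3 h X^3 + a1 X Y^2 + k0 Y^3
    with a1 a unit. For r = 0 its discriminant is -16 s (a1^3 + 27 s k0^2) up to
    multiples of p, which is where regularity enters; for r = 1 it is exactly
    divisible by p. *)
Lemma closed_order_flat (s : int) : ~~ (pi %| s)%Z -> point2_above p a b c s ->
  A s 0 != 0 -> A s 1 != 0 -> (pi %| A s 1)%Z -> (3 * w s 1 <= 2 * w s 0)%N ->
  ((2 * w s 0 = 3 * w s 1)%N ->
    ~~ (pi %| unit_part p (A s 1) ^+ 3 + 27 * s * unit_part p (A s 0) ^+ 2)%Z) ->
  exists e b2 a1 k0, closed_order s (w s 1 %/ 2) e b2 a1 k0 /\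
    ((w s 1 <= ordp p (disc f)) &&
     ((ordp p (disc f) - w s 1) %/ 2 == 2 * (w s 1 %/ 2) + e))%N.
Proof.
move=> ps dp A00 A10 pA1 le reg.
have w1 : (0 < w s 1)%N by rewrite -dvdz_ordp // expr1.
pose k := (w s 1 %/ 2)%N; pose r := (w s 1 %% 2)%N.
have wE : w s 1 = (2 * k + r)%N by rewrite /k /r mulnC -divn_eq.
have r2 : (r < 2)%N by rewrite ltn_mod.
pose u1 := unit_part p (A s 1); have pu : ~~ (pi %| u1)%Z by rewrite unit_part_ndvd.
have A1E : A s 1 = (pi ^+ k) ^+ 2 * pi ^+ r * u1.
  by rewrite -exprM -exprD (mulnC k) -wE mulrC unit_partE.
have [k0 A0E] : exists k0, A s 0 = (pi ^+ k) ^+ 3 * (pi ^+ r) ^+ 2 * k0.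
  have /dvdzP [k0 ->] : (pi ^+ (3 * k + r * 2) %| A s 0)%Z.
    apply: dvdz_of_ordp => // _; move: le; rewrite wE.
    by case: r r2 {wE A1E} => [|[|r]] //= _; clear; lia.
  by exists k0; rewrite -!exprM -exprD (mulnC k) mulrC.
have [b2 A2E] : exists b2, A s 2 = pi ^+ k * (pi * b2).
  have /dvdzP [b2 ->] : (pi ^+ k.+1 %| A s 2)%Z.
    apply: dp; first by rewrite A0E -exprM (mulnC k) -mulrA dvdz_mulr.
    by rewrite A1E -exprM (mulnC k) -mulrA dvdz_mulr.
  by exists b2; rewrite exprSr mulrC mulrA.
have p4s := ndvdzM pp p4 ps.
exists r, (pi * b2), u1, k0; rewrite -/k.
have dh := @ordp_disc_scaled s k r _ _ _ _ _ A2E A1E A0E.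
have A3E : A s 3 = 4 * s by rewrite taylor3.
move: r r2 wE A1E A0E dh => [|[|r]] //= _ wE A1E A0E dh.
  have k_gt0 : (0 < k)%N by move: w1; rewrite wE; clear; lia.
  have pk : (pi %| pi ^+ k)%Z by rewrite pX.
  have pD : ~~ (pi %| u1 ^+ 3 + 27 * s * k0 ^+ 2)%Z.
    have A0E' : A s 0 = k0 * pi ^+ (3 * k).
      by rewrite A0E expr1n mulr1 -exprM (mulnC k) mulrC.
    have [d0|pk0] := boolP (pi %| k0)%Z.
      rewrite rpredDr; last by rewrite dvdz_mull // expr2 dvdz_mull.
      by rewrite !exprS expr0 mulr1; apply: (ndvdzM pp pu (ndvdzM pp pu pu)).
    have w0E : w s 0 = (3 * k)%N by rewrite A0E' ordp_eq.
    rewrite -[k0](unit_part_eq pp (3 * k) pk0) -A0E'; apply: reg.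
    by rewrite w0E wE; clear; lia.
  have pC : ~~ (pi %| cubic_disc (4 * s * pi ^+ 0) (pi * b2) u1 k0)%Z.
    have -> : cubic_disc (4 * s * pi ^+ 0) (pi * b2) u1 k0
      = pi * (pi * b2 ^+ 2 * u1 ^+ 2 - 4 * pi ^+ 2 * b2 ^+ 3 * k0
              + 72 * s * b2 * u1 * k0)
        - 4 * (4 * s) * (u1 ^+ 3 + 27 * s * k0 ^+ 2) by rewrite /cubic_disc expr0; ring.
    rewrite rpredBl; last by rewrite dvdz_mulr.
    exact: (ndvdzM pp (ndvdzM pp p4 p4s) pD).
  have -> : ordp p (disc f) = (6 * k)%N.
    rewrite (dh 0%N _ (esym (mulr1 _))) ?addn0 ?muln0 ?addn0 //.
    rewrite rpredDr; last by rewrite dvdz_mulr.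
    rewrite A3E expr2; exact: (ndvdzM pp (ndvdzM pp p4s p4s) pC).
  split; last by rewrite wE; apply/andP; split; [|apply/eqP]; clear; lia.
  split=> //; last by constructor 1.
  by split; rewrite -?mulrA dvdz_mulr.
have ph : (pi %| pi ^+ 1)%Z by rewrite pX.
have -> : ordp p (disc f) = (6 * k + 3)%N.
  rewrite (dh 1%N (- (4 * A s 3 * A s 3 * A s 3 * (u1 * u1 * u1))
    + pi * (A s 3 ^+ 2 * (b2 ^+ 2 * u1 ^+ 2 - 4 * pi * b2 ^+ 3 * k0
              - 27 * A s 3 ^+ 2 * k0 ^+ 2 + 18 * A s 3 * b2 * u1 * k0)
       + pi ^+ k * (256 * (pi ^+ k) ^+ 2 * pi ^+ 2 * k0 ^+ 3
         - 192 * A s 3 * pi ^+ k * pi * u1 * k0 ^+ 2 - 128 * pi ^+ k * pi ^+ 2 * b2 ^+ 2 * k0 ^+ 2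
         + 144 * pi ^+ k * pi * b2 * u1 ^+ 2 * k0 - 27 * pi ^+ k * u1 ^+ 4
         + 144 * A s 3 ^+ 2 * pi * b2 * k0 ^+ 2 - 6 * A s 3 ^+ 2 * u1 ^+ 2 * k0
         - 80 * A s 3 * pi * b2 ^+ 2 * u1 * k0 + 18 * A s 3 * b2 * u1 ^+ 3
         + 16 * pi ^+ 2 * b2 ^+ 4 * k0 - 4 * pi * b2 ^+ 3 * u1 ^+ 2)))).
  - by clear; lia.
  - rewrite /cubic_disc /disc_rest expr1; move: (pi ^+ k) (A s 3) => P A3.
    by move: pi => q; ring.
  rewrite rpredDr; last by rewrite dvdz_mulr.
  rewrite rpredN A3E.
  exact: (ndvdzM pp (ndvdzM pp (ndvdzM pp (ndvdzM pp p4 p4s) p4s) p4s)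
            (ndvdzM pp (ndvdzM pp pu pu) pu)).
split; last by rewrite wE; apply/andP; split; [|apply/eqP]; clear; lia.
have dP : (pi %| pi ^+ k * pi ^+ 1)%Z by rewrite dvdz_mull.
split=> //.
  by split; rewrite ?(dvdz_mulr _ dP) // mulrCA dvdz_mulr.
constructor 3; split=> //; rewrite ?pX2n ?dvdz_mulr //.
by rewrite pu.
Qed.

(** After a step b2 is a unit, and mod p the reduced form has
    b2 X^2 + a1 X Y + k0 Y^2 as a factor, up to the term A3 h X^3. Either this
    quadratic form has unit discriminant (when the point of abscissa 1 is strictly
    below the chord from 0 to 2, or w_0 + k is even and the integer is regular), or
    w_0 + k is odd, a1 is divisible by p and k0 exactly divisible by p. *)
Lemma closed_order_iterate (s : int) k n : iterate_state p a b c k n s -> regular_int p f s ->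
  A s 0 != 0 ->
  exists e b2 a1 k0, closed_order s k e b2 a1 k0 /\
    ((2 * k <= ordp p (disc f)) && ((ordp p (disc f) - 2 * k) %/ 2 == 2 * k + e))%N.
Proof.
move=> st reg A00; have [ps /andP [k_gt0 kn] /andP [dA2 ndA2] dA0 dA1] := st.
have pk : (pi %| pi ^+ k)%Z by rewrite pX.
have [b2 A2E] : exists b2, A s 2 = pi ^+ k * b2.
  by have /dvdzP [b2 ->] := dA2; exists b2; rewrite mulrC.
have pb : ~~ (pi %| b2)%Z by move: ndA2; rewrite A2E exprSr dvdz_mul2l.
have p4s := ndvdzM pp p4 ps; have A3E : A s 3 = 4 * s by rewrite taylor3.
have w0 : (2 * n + k < w s 0)%N by rewrite -dvdz_ordp.
pose u0 := unit_part p (A s 0); have pu0 : ~~ (pi %| u0)%Z by rewrite unit_part_ndvd.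
have A0u : A s 0 = pi ^+ w s 0 * u0 by rewrite mulrC unit_partE.
have unram e a1 k0 : (0 < e)%N ->
    A s 1 = (pi ^+ k) ^+ 2 * pi ^+ e * a1 -> A s 0 = (pi ^+ k) ^+ 3 * (pi ^+ e) ^+ 2 * k0 ->
    ~~ (pi %| a1 ^+ 2 - 4 * k0 * b2)%Z -> closed_order s k e b2 a1 k0 /\
    ((2 * k <= ordp p (disc f)) && ((ordp p (disc f) - 2 * k) %/ 2 == 2 * k + e))%N.
  move=> e_gt0 A1E A0E pD.
  have ph : (pi %| pi ^+ e)%Z by rewrite pX.
  have pC : ~~ (pi %| cubic_disc (4 * s * pi ^+ e) b2 a1 k0)%Z.
    have -> : cubic_disc (4 * s * pi ^+ e) b2 a1 k0
      = pi ^+ e * (- 16 * s * a1 ^+ 3 - 27 * (4 * s) ^+ 2 * pi ^+ e * k0 ^+ 2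
                   + 72 * s * b2 * a1 * k0)
        + b2 * b2 * (a1 ^+ 2 - 4 * k0 * b2) by rewrite /cubic_disc; ring.
    rewrite rpredDl; last by rewrite dvdz_mulr.
    exact: (ndvdzM pp (ndvdzM pp pb pb) pD).
  have dE := @ordp_disc_scaled s k e 0 _ _ _ _ A2E A1E A0E (esym (mulr1 _)).
  rewrite dE; last first.
    rewrite rpredDr; last by rewrite dvdz_mulr.
    rewrite A3E expr2; exact: (ndvdzM pp (ndvdzM pp p4s p4s) pC).
  split; last by apply/andP; split; [|apply/eqP]; clear; lia.
  split=> //; last by constructor 1.
  by split; rewrite -?mulrA dvdz_mulr.
(* the point of abscissa 1 is a vertex *)
have [/andP [A10 lt1]|ge1] := boolP ((A s 1 != 0) && (2 * w s 1 < k + w s 0)%N).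
  have w1 : (n + k < w s 1)%N by rewrite -dvdz_ordp.
  pose u1 := unit_part p (A s 1); have pu1 : ~~ (pi %| u1)%Z by rewrite unit_part_ndvd.
  pose d := (w s 0 - (3 * k + (w s 1 - 2 * k) * 2))%N.
  exists (w s 1 - 2 * k)%N, b2, u1, (pi ^+ d * u0); apply: unram.
  - by move: w1 kn; clear; lia.
  - rewrite -exprM -exprD -{1}(unit_partE pp (A s 1)) mulrC; congr (_ ^+ _ * _).
    by move: w1 kn; clear; lia.
  - rewrite -!exprM -exprD mulrA -exprD {1}A0u; congr (_ ^+ _ * _).
    by move: w1 w0 lt1 kn; rewrite /d; clear; lia.
  have d_gt0 : (0 < d)%N by move: w1 w0 lt1 kn; rewrite /d; clear; lia.
  rewrite rpredBr; last by rewrite -!mulrA dvdz_mull // dvdz_mulr // pX.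
  by rewrite expr2; apply: (ndvdzM pp).
have w1 : (A s 1 != 0 -> k + w s 0 <= 2 * w s 1)%N.
  by move=> A10; move: ge1; rewrite A10 /= -leqNgt.
have [oddw|evenw] := boolP (odd (k + w s 0)).
  have [m wE] : exists m, (k + w s 0 = 2 * m + 2 * k + 1)%N.
    exists ((w s 0 - k - 1) %/ 2)%N; move: oddw w0 kn; clear; lia.
  pose e := (m - k)%N; have km : (k <= m)%N by move: wE w0 kn; clear; lia.
  have A0E : A s 0 = (pi ^+ k) ^+ 3 * (pi ^+ e) ^+ 2 * (pi * u0).
    rewrite -!exprM -exprD mulrA -exprSr {1}A0u; congr (_ ^+ _ * _).
    by rewrite /e; move: wE km; clear; lia.
  have [a1 A1E] : exists a1, A s 1 = (pi ^+ k) ^+ 2 * pi ^+ e * (pi * a1).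
    have /dvdzP [a1 ->] : (pi ^+ (k * 2 + e).+1 %| A s 1)%Z.
      apply: dvdz_of_ordp => // A10; have := w1 A10.
      by rewrite /e; move: wE km; clear; lia.
    by exists a1; rewrite -exprM -exprD exprSr mulrC mulrA.
  exists e, b2, (pi * a1), (pi * u0).
  have pkE : pi ^+ k = pi * pi ^+ k.-1 by rewrite -exprS prednK.
  have dE : ordp p (disc f) = (6 * k + 2 * e + 1)%N.
    apply: (@ordp_disc_scaled s k e 1 b2 (pi * a1) (pi * u0)
      (- (4 * A s 3 * A s 3 * (b2 * b2 * b2) * u0)
       + pi * (A s 3 ^+ 2 * (b2 ^+ 2 * a1 ^+ 2 - 4 * A s 3 * pi ^+ e * pi * a1 ^+ 3
                 - 27 * A s 3 ^+ 2 * (pi ^+ e) ^+ 2 * u0 ^+ 2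
                 + 18 * A s 3 * pi ^+ e * b2 * a1 * u0)
           + pi ^+ k.-1 * (256 * (pi ^+ k) ^+ 2 * (pi ^+ e) ^+ 4 * pi ^+ 2 * u0 ^+ 3
             - 192 * A s 3 * pi ^+ k * (pi ^+ e) ^+ 3 * pi ^+ 2 * a1 * u0 ^+ 2
             - 128 * pi ^+ k * (pi ^+ e) ^+ 2 * b2 ^+ 2 * pi * u0 ^+ 2
             + 144 * pi ^+ k * (pi ^+ e) ^+ 2 * b2 * pi ^+ 2 * a1 ^+ 2 * u0
             - 27 * pi ^+ k * (pi ^+ e) ^+ 2 * pi ^+ 3 * a1 ^+ 4
             + 144 * A s 3 ^+ 2 * (pi ^+ e) ^+ 2 * b2 * pi * u0 ^+ 2
             - 6 * A s 3 ^+ 2 * (pi ^+ e) ^+ 2 * pi ^+ 2 * a1 ^+ 2 * u0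
             - 80 * A s 3 * pi ^+ e * b2 ^+ 2 * pi * a1 * u0
             + 18 * A s 3 * pi ^+ e * b2 * pi ^+ 2 * a1 ^+ 3
             + 16 * b2 ^+ 4 * u0 - 4 * b2 ^+ 3 * pi * a1 ^+ 2))) A2E A1E A0E).
      rewrite expr1 /cubic_disc /disc_rest; move: (pi ^+ e) => h.
      move: (pi ^+ k) (pi ^+ k.-1) (A s 3) pkE => P Q A3 ->.
      by move: pi => q; ring.
    rewrite rpredDr; last by rewrite dvdz_mulr.
    rewrite rpredN A3E.
    exact: (ndvdzM pp (ndvdzM pp (ndvdzM pp (ndvdzM pp p4 p4s) p4s)
              (ndvdzM pp (ndvdzM pp pb pb) pb)) pu0).
  rewrite dE; split; last by apply/andP; split; [|apply/eqP]; clear; lia.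
  split=> //; first by split; rewrite -?mulrA dvdz_mulr.
  constructor 2; split; [by rewrite dvdz_mulr | by rewrite dvdz_mulr | | by rewrite pb].
  by rewrite expr2 dvdz_mul2l // -(expr1 pi).
have [m wE] : exists m, (w s 0 = 2 * m + k)%N.
  exists ((w s 0 - k) %/ 2)%N; move: evenw w0 kn; clear; lia.
have km : (k < m)%N by move: wE w0 kn; clear; lia.
have A0E : A s 0 = pi ^+ (2 * m + k) * u0 by rewrite -wE.
have [a1 A1E] : exists a1, A s 1 = pi ^+ (m + k) * a1.
  have /dvdzP [a1 ->] : (pi ^+ (m + k) %| A s 1)%Z.
    by apply: dvdz_of_ordp => // A10; have := w1 A10; rewrite wE; clear; lia.
  by exists a1; rewrite mulrC.
exists (m - k)%N, b2, a1, u0; apply: unram.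
- by rewrite subn_gt0.
- by rewrite -exprM -exprD A1E; congr (_ ^+ _ * _); move: km; clear; lia.
- by rewrite -!exprM -exprD A0E; congr (_ ^+ _ * _); move: km; clear; lia.
apply/negP => dD; have /negP := quad_side_irregular pp p_gt3 st km
  (And4 A0E A1E A2E (And3 pu0 pb dD)).
exact.
Qed.
End Criterion.

(** * The p-integral basis *)

Lemma floor_nat_div (n d : nat) : (0 < d)%N ->
  Num.floor (n%:R / d%:R : rat) = (n %/ d)%N%:Z.
Proof.
move=> d0; apply: floor_def; have d0' : (0 : rat) < d%:R by rewrite ltr0n.
rewrite ler_pdivlMr // ltr_pdivrMr // intrD -!pmulrn -natrD -!natrM ler_nat ltr_nat.
by rewrite leq_divM /= addn1 ltn_ceil.
Qed.

Section ScaledValuations.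
Variables (p : nat) (x y : int).
Hypothesis x0 : x != 0.

Lemma vp_lt : (2%:E * vp p x < 3%:E * vp p y)%E =
  (y == 0) || (2 * ordp p x < 3 * ordp p y)%N.
Proof.
rewrite /vp (negPf x0); have [_|y0] /= := eqVneq y 0.
  by rewrite gt0_muley ?lte_fin // ltry.
by rewrite -!EFinM lte_fin -!natrM ltr_nat.
Qed.

Lemma vp_eq_scaled : (2%:E * vp p x = 3%:E * vp p y)%E <->
  y != 0 /\ (2 * ordp p x = 3 * ordp p y)%N.
Proof.
rewrite /vp (negPf x0); have [_|y0] /= := eqVneq y 0.
  by rewrite gt0_muley ?lte_fin //; split=> [|[]].
rewrite -!EFinM -!natrM; split=> [[/eqP]|[_ ->] //].
by rewrite eqr_nat => /eqP.
Qed.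
End ScaledValuations.

Lemma vp_fin p x : x != 0 -> vp p x = ((ordp p x)%:R)%:E.
Proof. by rewrite /vp => /negPf ->. Qed.

Theorem lemma4p2 (p : nat) (a b c s0 : int) (K : fieldExtType rat) (theta : K) :
  let f : {poly int} := 'X^4 + a%:P * 'X^2 + b%:P * 'X + c%:P in
  let Delta := vp p (disc f) in
  let u0 := vp p f.[s0] in
  let u1 := vp p f^`().[s0] in
  let sigma0 := unit_part p f.[s0] in
  let sigma1 := unit_part p f^`().[s0] in
  let nu1 : int :=
    if (2%:E * u0 < 3%:E * u1)%E then Num.floor (2 * fine u0 / 3)
    else Num.floor ((fine Delta - fine u1) / 2) in
  let nu2 : int :=
    if (2%:E * u0 < 3%:E * u1)%E then Num.floor (fine u0 / 3)
    else Num.floor (fine u1 / 2) in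
  prime p -> (3 < p)%N ->
  irreducible_poly f ->
  root (map_poly intr f) theta ->
  <<1%VS; theta>>%VS = fullv ->
  (exists r : 'F_p, mup r (map_poly intr f) = 3%N) ->
  ~~ (p%:Z %| s0)%Z ->
  (a = - 6 * s0 ^+ 2 %[mod p])%Z ->
  (b = 8 * s0 ^+ 3 %[mod p])%Z ->
  (c = - 3 * s0 ^+ 4 %[mod p])%Z ->
  ((6^-1)%:E * Delta < vp p (a + 6 * s0 ^+ 2)%R)%E ->
  (~~ regular_int p f s0 <->
     (2%:E * u0 = 3%:E * u1)%E /\
     (p%:Z %| sigma1 ^+ 3 + 27 * s0 * sigma0 ^+ 2)%Z)
  /\
  (iteration_terminates p f s0 /\
   forall s : int, iteration_result p f s0 s ->
     pintegral_basis p
       [tuple 1;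
              theta;
              (theta ^+ 2 + 2 * s%:~R * theta + (3 * s ^+ 2 + a)%:~R)
                / p%:R ^ nu2;
              (theta ^+ 3 + s%:~R * theta ^+ 2 + (s ^+ 2 + a)%:~R * theta
                 + (s ^+ 3 + a * s + b)%:~R) / p%:R ^ nu1]).
Proof.
move=> f Delta u0 u1 sigma0 sigma1 nu1 nu2 pp p_gt3 f_irr f_root f_full _ ps.
move=> /eqP ea /eqP eb /eqP ec ltD.
have fE : f = quartic a b c by [].
have A0E : f.[s0] = taylor (quartic a b c) s0 0 by rewrite /taylor nderivn0.
have A1E : f^`().[s0] = taylor (quartic a b c) s0 1 by rewrite /taylor nderivn1.
have A2E : a + 6 * s0 ^+ 2 = taylor (quartic a b c) s0 2 by rewrite taylor2 addrC.
rewrite fE in f_irr f_root *.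
have A_neq0 s : taylor (quartic a b c) s 0 != 0.
  rewrite /taylor nderivn0; apply/negP => /factor_theorem [q qE].
  have : 'X - s%:P %= quartic a b c.
    by apply: f_irr.2; rewrite ?size_XsubC // qE dvdp_mulIr.
  by move/eqp_size; rewrite size_XsubC size_quartic.
rewrite !eqz_mod_dvd in ea eb ec.
have pA1 : (p%:Z %| taylor (quartic a b c) s0 1)%Z.
  have -> : taylor (quartic a b c) s0 1
    = 2 * s0 * (a - - 6 * s0 ^+ 2) + (b - 8 * s0 ^+ 3) by rewrite taylor1; ring.
  by rewrite rpredD // dvdz_mull.
have pA0 : (p%:Z %| taylor (quartic a b c) s0 0)%Z.
  have -> : taylor (quartic a b c) s0 0
    = s0 ^+ 2 * (a - - 6 * s0 ^+ 2) + s0 * (b - 8 * s0 ^+ 3) + (c - - 3 * s0 ^+ 4).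
    by rewrite taylor0; ring.
  by apply: rpredD => //; apply: rpredD; rewrite dvdz_mull.
have [disc0 A2lt] : disc (quartic a b c) != 0 /\
    (taylor (quartic a b c) s0 2 != 0 ->
     ordp p (disc (quartic a b c)) < 6 * ordp p (taylor (quartic a b c) s0 2))%N.
  move: ltD; rewrite /Delta fE A2E /vp; case: eqP => [_|_].
    by rewrite gt0_muley ?lte_fin ?invr_gt0 // ltNge leey.
  case: eqP => [_|_] //; rewrite -EFinM lte_fin => lt; split=> // _.
  by rewrite -(ltr_nat rat) natrM; move: lt; clear; lra.
have dp : point2_above p a b c s0 by apply: point2_above_of_disc.
rewrite /nu1 /nu2 /u0 /u1 /sigma0 /sigma1 /Delta fE -/f A0E A1E.
have pX0 k : p%:Z ^+ k != 0 by rewrite expf_neq0 // eqz_nat -lt0n prime_gt0.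
have part1 : ~~ regular_int p f s0 <->
     (2%:E * vp p (taylor (quartic a b c) s0 0) = 3%:E * vp p (taylor (quartic a b c) s0 1))%E /\
     (p%:Z %| unit_part p (taylor (quartic a b c) s0 1) ^+ 3
       + 27 * s0 * unit_part p (taylor (quartic a b c) s0 0) ^+ 2)%Z.
  rewrite (vp_eq_scaled _ _ (A_neq0 s0)) fE (start_irregularP pp p_gt3 ps dp).
  have p4 : ~~ (p%:Z %| 4)%Z.
    by rewrite dvdzE (Euclid_dvdM 2 2) // orbb gtnNdvd // ltnW.
  split=> [[mu [B0 [B1 [B2 [mu0 E0 E1 E2 [B00 B10 B20 D0]]]]]]|[[A10 wE] D0]].
    rewrite E0 E1 mulrC [_ * B0]mulrC !ordp_eq // !unit_part_eq //.
    split; first split; first 1 last.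
    - by rewrite mulnA [RHS]mulnA.
    - have : (p%:Z %| 4 * (B1 ^+ 3 + 27 * s0 * B0 ^+ 2))%Z.
        have -> // : 4 * (B1 ^+ 3 + 27 * s0 * B0 ^+ 2)
          = 4 * B1 ^+ 3 + 27 * taylor (quartic a b c) s0 3 * B0 ^+ 2.
        by rewrite taylor3; ring.
      by rewrite Euclid_dvdzM // (negPf p4).
    - by rewrite mulf_neq0 //; apply: contra B10 => /eqP ->; rewrite dvdz0.
  have w1 : (0 < ordp p (taylor (quartic a b c) s0 1))%N by rewrite -dvdz_ordp // expr1.
  set A0 := taylor _ s0 0 in wE D0 *; set A1 := taylor _ s0 1 in wE D0 w1 *.
  have [mu [e0 e1]] : exists mu, ordp p A0 = (3 * mu)%N /\ ordp p A1 = (2 * mu)%N.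
    by exists (ordp p A0 - ordp p A1)%N; move: wE; clear; lia.
  have E0 : A0 = p%:Z ^+ (3 * mu) * unit_part p A0 by rewrite mulrC -e0 unit_partE.
  have E1 : A1 = p%:Z ^+ (2 * mu) * unit_part p A1 by rewrite mulrC -e1 unit_partE.
  have /dvdzP [B2 E2] : (p%:Z ^+ mu.+1 %| taylor (quartic a b c) s0 2)%Z.
    by apply: dp; [rewrite -/A0 E0 | rewrite -/A1 E1]; rewrite dvdz_mulr.
  exists mu, (unit_part p A0), (unit_part p A1), (B2 * p%:Z); split=> //.
  - by move: w1; rewrite e1; clear; lia.
  - by rewrite E2 exprSr; ring.
  split; [exact: unit_part_ndvd (A_neq0 s0) | exact: unit_part_ndvd A10 | by rewrite dvdz_mull |].
  have -> : 4 * unit_part p A1 ^+ 3 + 27 * taylor (quartic a b c) s0 3 * unit_part p A0 ^+ 2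
    = 4 * (unit_part p A1 ^+ 3 + 27 * s0 * unit_part p A0 ^+ 2) by rewrite taylor3; ring.
  by rewrite dvdz_mull.
split; first exact: part1.
rewrite (vp_lt _ _ (A_neq0 s0)) !(vp_fin _ disc0) !(vp_fin _ (A_neq0 s0)) /=.
split; first exact: (start_terminates pp p_gt3 disc0 ps dp).
move=> s /(start_result pp p_gt3 ps dp) [reg [es|[mu [B0 [B1 [B2 [n [cs st]]]]]]]].
  (* no step: the two cases of the exponents are those of the polygon at s0 *)
  rewrite {s}es in reg *; case: ifP => [lt|/negbT].
    have lt' : (taylor (quartic a b c) s0 1 != 0 -> 2 * ordp p (taylor (quartic a b c) s0 0)
        < 3 * ordp p (taylor (quartic a b c) s0 1))%N.
      by case/orP: lt => [/eqP ->|//]; rewrite eqxx.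
    have [e [b2 [a1 [k0 [co floorE]]]]] :=
      closed_order_steep pp p_gt3 ps dp (A_neq0 s0) pA0 lt'.
    have -> : Num.floor (2 * (ordp p (taylor (quartic a b c) s0 0))%:R / 3 : rat)
      = (2 * (ordp p (taylor (quartic a b c) s0 0) %/ 3) + e)%N%:Z.
      by rewrite -natrM floor_nat_div // floorE.
    rewrite floor_nat_div //.
    exact: (closed_order_basis pp p_gt3 f_irr f_root f_full ps co).
  rewrite negb_or -leqNgt => /andP [A10 le].
  have indivisible : (2 * ordp p (taylor (quartic a b c) s0 0)
        = 3 * ordp p (taylor (quartic a b c) s0 1))%N ->
      ~~ (p%:Z %| unit_part p (taylor (quartic a b c) s0 1) ^+ 3
        + 27 * s0 * unit_part p (taylor (quartic a b c) s0 0) ^+ 2)%Z.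
    move=> wE; apply: contraL reg => D0; apply/part1; split=> //.
    exact/(vp_eq_scaled _ _ (A_neq0 s0)).
  have [e [b2 [a1 [k0 [co /andP [le1 /eqP floorE]]]]]] :=
    closed_order_flat pp p_gt3 ps dp (A_neq0 s0) A10 pA1 le
    indivisible.
  rewrite (vp_fin _ A10) /= -natrB // !floor_nat_div // floorE.
  exact: (closed_order_basis pp p_gt3 f_irr f_root f_full ps co).
(* at least one step: then 2 u0 = 3 u1 = 6 mu, and k = mu *)
have [mu0 E0 E1 _ [B00 B10 _ _]] := cs.
have e0 : ordp p (taylor (quartic a b c) s0 0) = (3 * mu)%N by rewrite E0 mulrC ordp_eq.
have e1 : ordp p (taylor (quartic a b c) s0 1) = (2 * mu)%N by rewrite E1 mulrC ordp_eq.
have A10 : taylor (quartic a b c) s0 1 != 0.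
  by rewrite E1 mulf_neq0 //; apply: contra B10 => /eqP ->; rewrite dvdz0.
rewrite (negPf A10) e0 e1 mulnCA ltnn /= (vp_fin _ A10) /= e1.
have [e [b2 [a1 [k0 [co /andP [le1 /eqP floorE]]]]]] :=
  closed_order_iterate pp p_gt3 st reg (A_neq0 s).
rewrite -natrB // !floor_nat_div // floorE mulKn //.
have [ps' _ _ _ _] := st.
exact: (closed_order_basis pp p_gt3 f_irr f_root f_full ps' co).
Qed.
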